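(* Let $(\Omega,\varphi)$ be an ordinary semicascade. Then all ergodic operator nets $T_\alpha\in G_0$ converge in the $\mathrm{W}^*\mathrm{O}$-topology if and only if, for each $\omega\in\Omega$, the closure $\overline{o}(\omega)$ of the trajectory of $\omega$ contains a unique minimal set. The same is true with nets replaced by sequences: all ergodic operator sequences $T_n\in G_0$ converge in the $\mathrm{W}^*\mathrm{O}$-topology if and only if, for each $\omega\in\Omega$, $\overline{o}(\omega)$ contains a unique minimal set.
   Context: $\Omega$ is a metrizable compact space and $\varphi:\Omega\to\Omega$ is a continuous (not necessarily invertible) map; $(\Omega,\varphi)$ is the corresponding semicascade. $X=C(\Omega)$ is the Banach space of continuous scalar functions, $X^*$ its dual (Borel measures on $\Omega$), with pairing $(x,\mu)=\int_\Omega x\,d\mu$. $U\in\mathrm{End}\,X$ is $(Ux)(\omega)=x(\varphi\omega)$, $V=U^*\in\mathrm{End}\,X^*$, $I$ is the identity; $\mathrm{End}$ denotes bounded linear operators. The $\mathrm{W}^*\mathrm{O}$-topology on $\mathrm{End}\,X^*$: $T_\alpha\to T$ iff $(x,T_\alpha y)\to(x,Ty)$ for all $x\in X$, $y\in X^*$. $G_0=\mathrm{co}\{V^n:n\ge 0\}$ (convex hull). A net (or sequence) of operators $T_\alpha\in G_0$ is ergodic if $T_\alpha(I-V)\to 0$ in the $\mathrm{W}^*\mathrm{O}$-topology. The enveloping semigroup $E(\Omega,\varphi)$ is the closure of $\{\varphi^n:n\ge 0\}$ in $\Omega^\Omega$ with the topology of pointwise convergence; $(\Omega,\varphi)$ is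 ordinary if $E(\Omega,\varphi)$ is metrizable. $\overline{o}(\omega)$ is the closure in $\Omega$ of $\{\varphi^n\omega:n\ge 0\}$. A minimal set is a nonempty closed set $m\subset\Omega$ with $\varphi m\subset m$ that has no proper subset with the same properties. *)

(* Defs.v *)
From HB Require Import structures.
From mathcomp Require Import all_boot all_order all_algebra.
From mathcomp Require Export complex.
From mathcomp Require Import all_classical all_reals all_analysis.

Set Implicit Arguments.
Unset Strict Implicit.
Unset Printing Implicit Defensive.

Import Order.TTheory GRing.Theory Num.Theory.
Import numFieldNormedType.Exports.

Local Open Scope classical_set_scope.
Local Open Scope ring_scope.

Definition metrizable (R : realType) (T : topologicalType) : Prop :=
  exists d : T -> T -> R,
    [/\ forall x, d x x = 0,
        forall x y, d x y = 0 -> x = y,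
        forall x y, d x y = d y x,
        forall x y z, d x z <= d x y + d y z
      & forall (x : T) (A : set T),
          nbhs x A <-> exists2 e : R, 0 < e & [set y | d x y < e] `<=` A].

Definition convex_hull (K : numDomainType) (E : lmodType K) (A : set E) :
    set E :=
  [set x | exists n (c : 'I_n -> K) (a : 'I_n -> E),
     [/\ forall i, 0 <= c i, \sum_(i < n) c i = 1, forall i, A (a i)
       & x = \sum_(i < n) c i *: a i]].

Definition directed (D : Type) (le : D -> D -> Prop) : Prop :=
  [/\ inhabited D,
      forall a, le a a,
      forall a b c, le a b -> le b c -> le a c
    & forall a b, exists2 c, le a c & le b c].

Definition tails (D : Type) (le : D -> D -> Prop) : set_system D :=
  [set A | exists a, forall b, le a b -> A b].

Section continuous_lmodule.
Variables (K : numFieldType) (S : topologicalType) (V : normedModType K).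
Notation C := (continuousType S V).

Let cts_opp (f : C) : continuous (fun s => - f s).
Proof. by move=> s; apply: cvgN; exact: cts_fun. Qed.

Let cts_add (f g : C) : continuous (fun s => f s + g s).
Proof. by move=> s; apply: cvgD; exact: cts_fun. Qed.

Let cts_scale (k : K) (f : C) : continuous (fun s => k *: f s).
Proof. by move=> s; apply: cvgZl_tmp; exact: cts_fun. Qed.

Definition cts_zero : C := cst 0.
Definition cts_oppf (f : C) : C := mkcts (@cts_opp f).
Definition cts_addf (f g : C) : C := mkcts (@cts_add f g).
Definition cts_scalef (k : K) (f : C) : C := mkcts (@cts_scale k f).

Let addA : associative cts_addf.
Proof. by move=> f g h; apply/continuousEP => s; exact: addrA. Qed.
Let addC : commutative cts_addf.
Proof. by move=> f g; apply/continuousEP => s; exact: addrC. Qed.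
Let add0 : left_id cts_zero cts_addf.
Proof. by move=> f; apply/continuousEP => s; exact: add0r. Qed.
Let addN : left_inverse cts_zero cts_oppf cts_addf.
Proof. by move=> f; apply/continuousEP => s; exact: addNr. Qed.

HB.instance Definition _ := GRing.isZmodule.Build C addA addC add0 addN.

Let scaleA (a b : K) (f : C) :
  cts_scalef a (cts_scalef b f) = cts_scalef (a * b) f.
Proof. by apply/continuousEP => s; exact: scalerA. Qed.
Let scale1 : left_id 1 cts_scalef.
Proof. by move=> f; apply/continuousEP => s; exact: scale1r. Qed.
Let scaleDr : right_distributive cts_scalef +%R.
Proof. by move=> a f g; apply/continuousEP => s; exact: scalerDr. Qed.
Let scaleDl (f : C) : {morph cts_scalef^~ f : a b / a + b}.
Proof. by move=> a b; apply/continuousEP => s; exact: scalerDl. Qed.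

HB.instance Definition _ :=
  GRing.Zmodule_isLmodule.Build K C scaleA scale1 scaleDr scaleDl.

End continuous_lmodule.

Notation cfun S K := (continuousType S K^o).

Section dual.
Variables (K : numFieldType) (Omega : topologicalType).
Notation X := (cfun Omega K).

(* ||x|| <= a for the supremum norm, and ||mu|| <= b for the dual norm. Bounds
   are used instead of suprema so that real and complex scalars can be treated
   alike; in K the hypothesis 0 <= a includes that a is real. *)
Definition norm_le (x : X) (a : K) : Prop := 0 <= a /\ forall w, `|x w| <= a.

Definition dnorm_le (mu : X -> K^o) (b : K) : Prop :=
  0 <= b /\ forall x a, norm_le x a -> `|mu x| <= b * a.

Definition bounded_functional : {pred X -> K^o} :=
  [pred mu | `[< linear mu /\ exists b, dnorm_le mu b >] ].

Let bounded_functional_submod : submod_closed bounded_functional.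
Proof.
split=> [|k mu nu]; rewrite !inE.
  split=> [a x y|]; first by rewrite /GRing.zero/= scaler0 addr0.
  by exists 0; split=> // x a _; rewrite normr0 mul0r.
move=> [lmu [b [b0 hb]]] [lnu [c [c0 hc]]]; split=> [a x y|].
  rewrite !fctE lmu lnu !scalerDr addrACA; congr (_ + _ + _).
  by rewrite !scalerA mulrC.
exists (`|k| * b + c); split=> [|x a xa]; first by rewrite addr_ge0 ?mulr_ge0.
rewrite (le_trans (ler_normD _ _))// mulrDl lerD//; last exact: hc.
by rewrite normrM -mulrA ler_wpM2l// hb.
Qed.
HB.instance Definition _ := GRing.isSubmodClosed.Build K (X -> K^o)
  bounded_functional bounded_functional_submod.

(* X^*; by the Riesz theorem these functionals are the Borel measures, the value
   mu x being the integral of x against mu. *)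
Record dual := Dual {
  dual_val :> X -> K^o;
  dual_valP : dual_val \in bounded_functional }.

HB.instance Definition _ := [isSub for dual_val].
HB.instance Definition _ := [Choice of dual by <:].
HB.instance Definition _ := [SubChoice_isSubLmodule of dual by <:].

Definition bounded_operator : set (dual -> dual) :=
  [set T : dual -> dual | linear T /\
     exists b, forall (mu : dual) a, dnorm_le mu a -> dnorm_le (T mu) (b * a)].

Definition pairing (x : X) (mu : dual) : K^o := mu x.

(* The W*O-topology on End X^*, given by its convergent families: T i mu tends
   to S mu weakly-* for each mu. *)
Definition wso_cvg (I : Type) (F : set_system I) (T : I -> dual -> dual)
    (S : dual -> dual) : Prop :=
  forall x mu, (fun i => pairing x (T i mu)) @ F --> pairing x (S mu).

Definition wso_convergent (I : Type) (F : set_system I)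
    (T : I -> dual -> dual) : Prop :=
  exists2 S, bounded_operator S & wso_cvg F T S.

Variable phi : continuousType Omega Omega.

Definition koopman (x : X) : X := x \o phi.

Let koopman_adjoint_subproof (mu : dual) : mu \o koopman \in bounded_functional.
Proof.
case: mu => mu /=; rewrite !inE => -[lmu [b [b0 hb]]]; split=> [a x y|].
  rewrite /= -lmu; congr (mu _); exact/continuousEP.
by exists b; split=> // x a [a0 xa]; apply: hb; split=> // w; exact: xa.
Qed.

Definition koopman_adjoint (mu : dual) : dual :=
  Dual (koopman_adjoint_subproof mu).

Notation V := koopman_adjoint.

Definition G0 : set (dual -> dual) :=
  convex_hull (range (fun n => iter n V)).

Definition ergodic (I : Type) (F : set_system I) (T : I -> dual -> dual) :
    Prop :=
  (forall i, G0 (T i)) /\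
  wso_cvg F (fun i => T i \o (idfun \- V)) (fun=> 0).

Definition ergodic_nets_converge : Prop :=
  forall (D : Type) (le : D -> D -> Prop) (T : D -> dual -> dual),
    directed le -> ergodic (tails le) T -> wso_convergent (tails le) T.

Definition ergodic_sequences_converge : Prop :=
  forall T : nat -> dual -> dual, ergodic \oo T -> wso_convergent \oo T.

End dual.

Section semicascade.
Variables (Omega : topologicalType) (phi : Omega -> Omega).

Definition enveloping_semigroup : set {ptws Omega -> Omega} :=
  closure (range (fun n => iter n phi : {ptws Omega -> Omega})).

Definition orbit_closure (w : Omega) : set Omega :=
  closure (range (fun n => iter n phi w)).

Definition closed_invariant (m : set Omega) : Prop :=
  [/\ m !=set0, closed m & phi @` m `<=` m].

Definition minimal_set (m : set Omega) : Prop :=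
  closed_invariant m /\
  forall m', closed_invariant m' -> m' `<=` m -> m' = m.

End semicascade.

(* [set_type] carries the subspace topology. *)
Definition ordinary (R : realType) (Omega : topologicalType)
    (phi : Omega -> Omega) : Prop :=
  metrizable R (set_type (enveloping_semigroup phi)).

(* Main.v *)
Require Import Defs.
From mathcomp Require Import all_boot all_order all_algebra.
From mathcomp Require Import all_classical all_reals all_analysis.
From mathcomp Require Import lra.
Set Implicit Arguments.
Unset Strict Implicit.
Unset Printing Implicit Defensive.
Import Order.TTheory GRing.Theory Num.Theory.
Import numFieldNormedType.Exports.
Local Open Scope classical_set_scope.
Local Open Scope ring_scope.

(** If the closure of the trajectory of w contains two minimal sets m and m',
    the averages n^-1 (V^k + ... + V^(k+n-1)) with k = k_n chosen so that
    phi^k w is very close to m for even n and to m' for odd n form an ergodic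
    sequence that diverges at the Dirac measure of w.

    Conversely let the enveloping semigroup E be metrizable.  By compactness of
    E, for every x in C(Omega) and e > 0, countably many sets C_j cover Omega on
    each of which all the functions x o phi^n oscillate by at most e.  This has
    two consequences.  By Baire's theorem every minimal set has an open subset
    of small oscillation, so that limits of ergodic averages of x are constant
    on it.  By bounded convergence, pointwise convergence of convex combinations
    of the x o phi^n along a net implies convergence of their integrals.  An
    invariant functional on the closure of the trajectory of w lives on the
    minimal set m in it: some p in E maps this closure into m, and p is the limit
    of a sequence of iterates of phi.  So the limit of the averages at w is the
    constant found on m. *)

(** * Bounded convergence for functionals *)

(** Cluster points stand in for convergent subsequences, since the lemma is also applied in
    [{ptws Omega -> Omega}], which need not be first countable. *)
Lemma compact_seq_cluster (T : topologicalType) (m : set T) (w : nat -> T) :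
  compact m -> (forall n, m (w n)) ->
  exists2 p, m p & forall U N, nbhs p U -> exists2 n, (N <= n)%N & U (w n).
Proof.
move=> cm mw; have [|p [mp clp]] := cm (w @ \oo).
  by exists 0%N => // n _; exact: mw.
exists p => // U N pU.
have NF : (w @ \oo) (w @` [set n | (N <= n)%N]).
  by exists N => // n /= Nn; exists n.
by have [_ [[n Nn <-] Un]] := clp _ _ NF pU; exists n.
Qed.

Lemma clamp_le (R : realDomainType) (u v : R) : 0 <= u ->
  `|Num.max (- u) (Num.min u v)| <= u.
Proof.
move=> u0; rewrite ler_norml le_max lexx/= ge_max ge_min lexx/= andbT.
by rewrite (le_trans _ u0)// oppr_le0.
Qed.

(** Truncating at level [min u v] a number of modulus at most [u + v] leaves at most
    [u + v - min u v], which is [max u v]. *)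
Lemma clamp_rest_le (R : realFieldType) (u v x y a : R) :
  0 <= u <= a -> 0 <= v <= a -> `|x| <= u -> `|y| <= v ->
  `|x + y - Num.max (- Num.min u v) (Num.min (Num.min u v) (x + y))|
    <= Num.max u v.
Proof.
move=> /andP[? ?] /andP[? ?]; rewrite !ler_norml => /andP[? ?] /andP[? ?].
rewrite /Num.max /Num.min /Order.max /Order.min.
by case: (ltP u v) => ?; case: (ltP _ (x + y)) => ?; case: (ltP (- _) _) => ?;
   apply/andP; split; lra.
Qed.

Section bounded_functional.
Context {R : realType} {T : topologicalType}.
Implicit Types (f g h : T -> R) (mu : (T -> R) -> R) (m : set T).

(** Stands for a signed measure carried by [m] with total variation at most [b]: only values on [m]
    enter the bound. The functional takes all functions as arguments but is constrained on
    continuous ones only. *)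
Definition bounded_on m (b : R) mu : Prop :=
  [/\ 0 <= b,
      forall f g, continuous f -> continuous g -> mu (f \+ g) = mu f + mu g,
      forall (k : R) f, continuous f -> mu (k \*o f) = k * mu f
    & forall f a, continuous f -> 0 <= a -> (forall w, m w -> `|f w| <= a) ->
        `|mu f| <= b * a].

Lemma max_fun_continuous f g : continuous f -> continuous g ->
  continuous (f \max g).
Proof. by move=> cf cg w; exact: (@continuous_max R T f g w (cf w) (cg w)). Qed.

Lemma min_fun_continuous f g : continuous f -> continuous g ->
  continuous (f \min g).
Proof. by move=> cf cg w; exact: (@continuous_min R T f g w (cf w) (cg w)). Qed.

Lemma abs_fun_continuous f : continuous f -> continuous (fun w => `|f w|).
Proof. by move=> cf w; apply: cvg_norm; exact: cf. Qed.

Lemma clamp_continuous f g : continuous f -> continuous g ->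
  continuous (fun w => Num.max (- f w) (Num.min (f w) (g w))).
Proof.
move=> cf cg; apply: max_fun_continuous; last exact: min_fun_continuous.
by move=> w; apply: cvgN; exact: cf.
Qed.

Section tv.
Variables (m : set T) (b : R) (mu : (T -> R) -> R).
Hypothesis mub : bounded_on m b mu.

Let tv_set f : set R :=
  [set `|mu g| | g in [set g | continuous g /\ forall w, m w -> `|g w| <= f w]].
(** For continuous [f], nonnegative on [m], this is the integral of [f] against the absolute value
    of the measure [mu]. *)
Definition total_variation f : R := sup (tv_set f).
Notation tv := total_variation.

Lemma bounded_on_opp f : continuous f -> mu (\- f) = - mu f.
Proof.
move=> cf; have [_ _ muZ _] := mub.
rewrite -mulN1r -muZ//; congr (mu _); apply/funext => w /=.
by rewrite mulN1r.
Qed.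

Let tv_has_sup f a : 0 <= a -> (forall w, m w -> 0 <= f w <= a) ->
  has_sup (tv_set f).
Proof.
move=> a0 fa; have [_ _ _ bmu] := mub; split.
  exists `|mu (cst 0)|; exists (cst 0) => //.
  split; first exact: cst_continuous.
  by move=> w /fa /andP[f0 _]; rewrite normr0.
exists (b * a) => _ [g [cg gf] <-]; apply: bmu => // w mw.
by rewrite (le_trans (gf _ mw))//; case/andP: (fa _ mw).
Qed.

Lemma le_total_variation f g a : 0 <= a -> (forall w, m w -> 0 <= f w <= a) ->
  continuous g -> (forall w, m w -> `|g w| <= f w) -> `|mu g| <= tv f.
Proof.
move=> a0 fa cg gf; apply: ub_le_sup; last by exists g.
exact: (tv_has_sup a0 fa).2.
Qed.

Lemma total_variation_le f a : 0 <= a -> (forall w, m w -> 0 <= f w <= a) ->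
  tv f <= b * a.
Proof.
move=> a0 fa; have [_ _ _ bmu] := mub; apply: ge_sup.
  exact: (tv_has_sup a0 fa).1.
move=> _ [g [cg gf] <-]; apply: bmu => // w mw.
by rewrite (le_trans (gf _ mw))//; case/andP: (fa _ mw).
Qed.

Let signed f g a : 0 <= a -> (forall w, m w -> 0 <= f w <= a) ->
  continuous g -> (forall w, m w -> `|g w| <= f w) ->
  exists g', [/\ continuous g', forall w, m w -> `|g' w| <= f w
    & mu g' = `|mu g|].
Proof.
move=> a0 fa cg gf; case: (lerP 0 (mu g)) => [mu0|mu0].
  by exists g; split=> //; rewrite ger0_norm.
exists (\- g); split.
- by move=> w; apply: cvgN; exact: cg.
- by move=> w mw /=; rewrite normrN; exact: gf.
- by rewrite bounded_on_opp// ltr0_norm.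
Qed.

(* Supermodularity: if |g1| <= f1 and |g2| <= f2, truncate g1 + g2 at the level
   min f1 f2; the remainder is then at most max f1 f2. *)
Lemma total_variation_minmax a f1 f2 : 0 <= a ->
  continuous f1 -> continuous f2 ->
  (forall w, m w -> 0 <= f1 w <= a) -> (forall w, m w -> 0 <= f2 w <= a) ->
  tv f1 + tv f2 <= tv (f1 \min f2) + tv (f1 \max f2).
Proof.
move=> a0 cf1 cf2 f1a f2a; have [_ muD _ _] := mub.
have mina w : m w -> 0 <= (f1 \min f2) w <= a.
  by move=> mw; move: (f1a _ mw) (f2a _ mw); rewrite /= /Order.min; case: ifP.
have maxa w : m w -> 0 <= (f1 \max f2) w <= a.
  by move=> mw; move: (f1a _ mw) (f2a _ mw); rewrite /= /Order.max; case: ifP.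
rewrite -lerBrDr; apply: ge_sup; first exact: (tv_has_sup a0 f1a).1.
move=> _ [g1 [cg1 g1f] <-]; rewrite lerBrDr -lerBrDl.
apply: ge_sup; first exact: (tv_has_sup a0 f2a).1.
move=> _ [g2 [cg2 g2f] <-]; rewrite lerBrDl.
have [g1' [cg1' g1f' <-]] := signed a0 f1a cg1 g1f.
have [g2' [cg2' g2f' <-]] := signed a0 f2a cg2 g2f.
have cmin := min_fun_continuous cf1 cf2.
have cg : continuous (g1' \+ g2').
  by move=> w; apply: cvgD; [exact: cg1'|exact: cg2'].
set h := fun w => Num.max (- (f1 \min f2) w)
                   (Num.min ((f1 \min f2) w) ((g1' \+ g2') w)).
have ch : continuous h by exact: clamp_continuous.
have ch' : continuous ((g1' \+ g2') \+ (\- h)).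
  by move=> w; apply: cvgB; [exact: cg|exact: ch].
rewrite -muD//.
have -> : (g1' \+ g2') = h \+ ((g1' \+ g2') \+ (\- h)).
  by apply/funext => w /=; lra.
rewrite muD// lerD// (le_trans (ler_norm _))//.
- apply: (le_total_variation a0) => // w mw.
  by rewrite clamp_le//; case/andP: (mina _ mw).
- apply: (le_total_variation a0) => // w mw.
  move: (f1a _ mw) (f2a _ mw) (g1f' _ mw) (g2f' _ mw).
  exact: clamp_rest_le.
Qed.



Hypothesis cm : compact m.

(** Points where [g n] is still at least [e] cluster at some [p] in [m]; some [g n] is below [e]
    near [p], and monotonicity gives a contradiction. *)
Lemma dini_compact (g : nat -> T -> R) : (forall n, continuous (g n)) ->
  (forall n w, m w -> g n.+1 w <= g n w) ->
  (forall w, m w -> forall e, 0 < e -> exists n, g n w < e) ->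
  forall e, 0 < e -> exists n, forall w, m w -> g n w < e.
Proof.
move=> cg dg g0 e e0; apply: contrapT => /forallNP gN.
have /choice[w wP] n : exists w, m w /\ e <= g n w.
  have /existsNP[w /not_implyP[mw /negP]] := gN n.
  by rewrite -leNgt; exists w.
have [p mp clp] := compact_seq_cluster cm (fun n => (wP n).1).
have [n gnp] := g0 p mp e e0.
have /(clp _ n)[k nk /= gnk] : nbhs p (g n @^-1` [set x | x < e]).
  by apply: (cg n p); exact: lt_nbhsl.
have : g k (w k) <= g n (w k).
  elim: k nk {gnk} (w k) (wP k).1 => [|k IH]; first by rewrite leqn0 => /eqP->.
  rewrite leq_eqVlt => /predU1P[->//|nk] v mv.
  exact: le_trans (dg _ _ mv) (IH nk _ mv).
by rewrite leNgt (lt_le_trans gnk (wP k).2).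
Qed.

Let bounded_on_cvg0_1 (h : nat -> T -> R) : (forall n, continuous (h n)) ->
  (forall n w, m w -> `|h n w| <= 1) ->
  (forall w, m w -> h ^~ w @ \oo --> 0) -> mu (h n) @[n --> \oo] --> 0.
Proof.
move=> ch h1 h0.
(* On [m], such an [f] lies between 0 and the supremum of [|h k|] over [k >= N]. Quantifying over
   the upper bounds [u] avoids forming this supremum, which need not be continuous. *)
pose P N f := continuous f /\ forall w, m w -> 0 <= f w /\
  forall u, 0 <= u -> (forall k, (N <= k)%N -> `|h k w| <= u) -> f w <= u.
have PS N f : P N.+1 f -> P N f.
  move=> [cf fu]; split=> // w mw; have [f0 f1] := fu _ mw; split=> // u u0 hu.
  by apply: f1 => // k /ltnW; exact: hu.
have Pmin N f g : P N f -> P N g -> P N (f \min g).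
  move=> [cf fu] [cg gu]; split=> [|w mw]; first exact: min_fun_continuous.
  have [f0 f1] := fu _ mw; have [g0 g1] := gu _ mw; split=> /=.
    by rewrite le_min f0.
  by move=> u u0 hu; rewrite ge_min f1.
have Pmax N f g : P N f -> P N g -> P N (f \max g).
  move=> [cf fu] [cg gu]; split=> [|w mw]; first exact: max_fun_continuous.
  have [f0 f1] := fu _ mw; have [g0 g1] := gu _ mw; split=> /=.
    by rewrite le_max f0.
  by move=> u u0 hu; rewrite ge_max f1// g1.
have P1 N f : P N f -> forall w, m w -> 0 <= f w <= 1.
  move=> [_ fu] w mw; have [f0 f1] := fu _ mw; rewrite f0/=.
  by apply: f1 => // k _; exact: h1.
have Ph N k : (N <= k)%N -> P N (fun w => `|h k w|).
  move=> Nk; split=> [|w mw]; first exact: abs_fun_continuous.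
  by split=> // u u0; exact.
have P0 w e : m w -> 0 < e -> exists N, forall f, P N f -> f w < e.
  move=> mw e0; have e2 : 0 < e / 2 by rewrite divr_gt0.
  have /cvgrPdist_le/(_ _ e2)[N _ hN] := h0 _ mw.
  exists N => f [_ fu]; rewrite (@le_lt_trans _ _ (e / 2))//; last by lra.
  apply: (fu _ mw).2; first exact: ltW.
  by move=> k /hN; rewrite /= sub0r normrN.
pose c N := sup [set tv f | f in P N].
have csup N : has_sup [set tv f | f in P N].
  split.
    exists (tv (fun w => `|h N w|)), (fun w => `|h N w|) => //; exact: Ph.
  exists (b * 1) => _ [f fP <-]; apply: total_variation_le => //.
  exact: P1 fP.
have le_c N f : P N f -> tv f <= c N.
  by move=> fP; apply: ub_le_sup; [exact: (csup N).2|exists f].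
apply/cvgrPdist_le => e e0.
have b0 : 0 <= b by have [] := mub.
(* The final error is [d * b], from [g N < d], plus [d], for the accumulated losses of the
   near-maximal choices [F]; the summand 1 covers [b = 0]. *)
pose d := e / (b + 1).
have d0 : 0 < d by rewrite divr_gt0// ltr_wpDl.
have eE : e = d * b + d.
  by rewrite /d -{2}(mulr1 (e / _)) -mulrDr divfK// gt_eqF// ltr_wpDl.
have /choice[F FP] N : exists f, P N f /\ c N - d / 2 ^+ N.+1 < tv f.
  have dN : 0 < d / 2 ^+ N.+1 by rewrite divr_gt0// exprn_gt0.
  by have [_ [f fP <-] cf] := sup_adherent dN (csup N); exists f.
pose g := fix g N := if N is N'.+1 then g N' \min F N'.+1 else F 0%N.
(* The losses [d / 2 ^+ j.+1] for [j <= N] add up to the bound shown. In the induction step, the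
   maximum of [g N] and [F N.+1] stays in [P N], so its total variation is at most [c N], and
   supermodularity bounds that of the minimum from below. *)
have gP N : P N (g N) /\ c N - d * (1 - (2 ^+ N.+1)^-1) <= tv (g N).
  elim: N => [|N [gN cN]].
    have [FP0 F0] := FP 0%N; split=> //=; move: F0; rewrite !expr1.
    by move: (tv _) (c _) => u v; lra.
  have [PF cF] := FP N.+1.
  have PgS : P N.+1 (g N.+1).
    split; first exact: (min_fun_continuous gN.1 PF.1).
    move=> w mw; have [F0 F1] := PF.2 _ mw; have [g0 _] := gN.2 _ mw; split=> /=.
      by rewrite le_min g0.
    by move=> u u0 hu; rewrite ge_min F1 ?orbT.
  split=> //=.
  have PFN := PS _ _ PF.
  have := total_variation_minmax (@ler01 R) gN.1 PF.1 (P1 _ _ gN) (P1 _ _ PFN).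
  have := le_c N _ (Pmax _ _ _ gN PFN).
  move: cF cN; have -> : (2 ^+ N.+1)^-1 = 2 * (2 ^+ N.+2)^-1 :> R.
    by rewrite (exprS 2 N.+1) invfM mulrA divff// mul1r.
  move: (_^-1) (tv _) (tv _) (tv _) (tv _) (c _) (c _) => q t1 t2 t3 t4 c1 c2.
  lra.
have [N gN] : exists N, forall w, m w -> g N w < d.
  apply: dini_compact => // [n|n w mw|w mw u u0].
  - exact: (gP n).1.1.
  - by rewrite /= ge_min lexx.
  - by have [n nP] := P0 _ _ mw u0; exists n; apply: nP; exact: (gP n).1.
exists N => // k /= Nk; rewrite sub0r normrN.
have -> : e = d * b + d by [].
apply: le_trans (_ : tv (fun w => `|h k w|) <= _).
  exact: (le_total_variation ler01 (P1 _ _ (Ph _ _ Nk)) (ch k)).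
apply: (le_trans (le_c _ _ (Ph _ _ Nk))).
have tvg : tv (g N) <= b * d.
  apply: total_variation_le; first exact: ltW.
  move=> w mw; rewrite (ltW (gN _ mw)) andbT.
  by case/andP: (P1 _ _ (gP N).1 _ mw).
have : 0 < d * (2 ^+ N.+1)^-1 by rewrite divr_gt0// exprn_gt0.
by have := (gP N).2; rewrite mulrBr mulr1; lra.
Qed.

(* Arzela's bounded convergence theorem.  It avoids measures: choose f_N below
   sup_(k >= N) |h_k| with nearly maximal total variation; by supermodularity
   the total variation of min f_0 ... f_N stays nearly maximal, while it tends
   to 0 by Dini's theorem. *)
Lemma bounded_on_cvg0 (h : nat -> T -> R) (a : R) :
  (forall n, continuous (h n)) ->
  (forall n w, m w -> `|h n w| <= a) ->
  (forall w, m w -> h ^~ w @ \oo --> 0) -> mu (h n) @[n --> \oo] --> 0.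
Proof.
move=> ch ha h0; have [_ _ muZ _] := mub; pose c := `|a| + 1.
have c0 : 0 < c by rewrite ltr_wpDl.
have -> : (fun n => mu (h n)) = (fun n => c * mu (c^-1 \*o h n)).
  by apply/funext => n; rewrite muZ// mulVKf// gt_eqF.
rewrite -(mulr0 c); apply: cvgM; first exact: cvg_cst.
apply: bounded_on_cvg0_1 => [n w|n w mw|w mw].
- by apply: cvgM; [exact: cvg_cst|exact: ch].
- rewrite /= normrM gtr0_norm ?invr_gt0// mulrC ler_pdivrMr// mul1r.
  by rewrite (le_trans (ha _ _ mw))// (le_trans (ler_norm a))// lerDl.
- rewrite -(mulr0 c^-1); apply: cvgM; [exact: cvg_cst|exact: h0].
Qed.

End tv.
End bounded_functional.

(** * Sets of small oscillation *)

Section small_oscillation.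
Context {R : realType} {T : topologicalType}.

(* Only countably many sets of small oscillation are needed to cover, so that
   pointwise convergence along an arbitrary filter passes to the functional,
   which fails for general families of functions. *)
Lemma bounded_on_cvg0_filter (m : set T) (b : R) (mu : (T -> R) -> R)
    (I : Type) (F : set_system I) (h : I -> T -> R) (a : R) :
  Filter F -> bounded_on m b mu -> compact m ->
  (forall i, continuous (h i)) -> (forall i w, m w -> `|h i w| <= a) ->
  (forall e : R, 0 < e -> exists2 C : nat -> set T,
     (forall w, m w -> exists j, C j w) &
     forall j w w' i, C j w -> C j w' -> `|h i w - h i w'| <= e) ->
  (forall w, m w -> h ^~ w @ F --> 0) -> mu (h i) @[i --> F] --> 0.
Proof.
move=> FF mub cm ch ha cov h0; have [b0 muD muZ bmu] := mub.
(* Truncating [h i] at level [2 * d] leaves a part contributing at most [b * (2 * d)]; the remainder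
   is to contribute less than [d]. *)
apply/cvgrPdist_le => e e0; pose d := e / (2 * b + 1).
have d0 : 0 < d by rewrite divr_gt0//; lra.
have d20 : 0 <= 2 * d by lra.
have eE : e = b * (2 * d) + d.
  have : d * (2 * b + 1) = e by rewrite divfK// gt_eqF//; lra.
  by lra.
have [C mC oscC] := cov _ d0.
pose small N i := forall j w, (j <= N)%N -> m w -> C j w -> `|h i w| <= 2 * d.
(* Otherwise each [N] has an index [i N] that is small on the first sets but has a large integral.
   The excess [r n] over the level [2 * d] vanishes eventually at each point, so bounded convergence
   applies to this sequence. *)
have [N muN] : exists N, forall i, small N i -> `|mu (h i)| <= e.
  apply: contrapT => /forallNP muN.
  have /choice[i iP] N : exists i, small N i /\ e < `|mu (h i)|.
    have /existsNP[i /not_implyP[si /negP]] := muN N.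
    by rewrite -ltNge; exists i.
  pose q n := fun w => Num.max (- (2 * d)) (Num.min (2 * d) (h (i n) w)).
  have cq n : continuous (q n).
    by apply: (@clamp_continuous _ _ (cst (2 * d))) => //; exact: cst_continuous.
  pose r n := h (i n) \+ (\- q n).
  have cr n : continuous (r n).
    by move=> w; apply: cvgB; [exact: ch|exact: cq].
  have : mu (r n) @[n --> \oo] --> 0.
    apply: (@bounded_on_cvg0 _ _ _ _ _ mub cm r (a + 2 * d)) => // [n w mw|w mw].
      rewrite (le_trans (ler_normD _ _))// normrN lerD ?ha//.
      exact: clamp_le.
    have [j Cj] := mC _ mw; apply: (@cvg_near_cst _ _ _ _ \oo).
    exists j => // n /= jn; rewrite /r /q/=.
    have := (iP n).1 _ _ jn mw Cj; rewrite ler_norml => /andP[l1 l2].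
    by rewrite (min_idPr l2) (max_idPr l1) subrr.
  move=> /cvgrPdist_lt/(_ _ d0)[n _ /(_ n (leqnn _))].
  rewrite /= sub0r normrN => mur.
  have := (iP n).2.
  have -> : h (i n) = r n \+ q n by apply/funext => w; rewrite /r/= subrK.
  rewrite muD// => /lt_le_trans/(_ (ler_normD _ _)).
  have : `|mu (q n)| <= b * (2 * d).
    by apply: bmu => // w mw; exact: clamp_le.
  by move: (mu _) (mu _) mur => u v; lra.
(* Only finitely many sets are involved; on each one that meets [m], a bound [d] at a single point
   plus the oscillation [d] gives [2 * d]. *)
have sN : \forall i \near F, small N i.
  have : \forall i \near F, forall j : 'I_N.+1, forall w, m w -> C j w ->
      `|h i w| <= 2 * d.
    apply: filter_forall => j.
    have [[w [mw Cw]]|nC] := pselect (exists w, m w /\ C j w); last first.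
      by apply: nearW => i w mw Cw; exfalso; apply: nC; exists w.
    have /cvgrPdist_le/(_ _ d0) := h0 _ mw.
    apply: filterS => i; rewrite sub0r normrN => hi w' mw' Cw'.
    have := ler_normD (h i w) (h i w' - h i w).
    rewrite addrCA subrr addr0 => /le_trans; apply.
    by have := oscC _ _ _ i Cw' Cw; lra.
  by apply: filterS => i si j w; rewrite -ltnS => jN; exact: (si (Ordinal jN)).
by apply: filterS sN => i /muN; rewrite sub0r normrN.
Qed.

(* A point w is coded by a modulus k of equicontinuity of n |-> x (phi^n w) for
   the pseudometric D and the rounded values of this sequence on a finite
   1/k-net. *)
Lemma countable_small_oscillation (phi : T -> T) (D : nat -> nat -> R)
    (x : T -> R) :
  (forall d, 0 < d -> exists N, forall n, exists2 k, (k < N)%N & D n k < d) ->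
  (forall w e, 0 < e -> exists2 d, 0 < d & forall n k, D n k < d ->
     `|x (iter n phi w) - x (iter k phi w)| <= e) ->
  forall e : R, 0 < e -> exists2 C : nat -> set T,
    (forall w, exists j, C j w) &
    forall j w w' n, C j w -> C j w' ->
      `|x (iter n phi w) - x (iter n phi w')| <= e.
Proof.
(* One [d] for passing from [n] to a net index [i] at [w], one for the same at [w'], and one for the
   rounding. *)
move=> tD eD e e0; have [d d0 dE] : exists2 d : R, 0 < d & e = 3 * d.
  by exists (e / 3); lra.
have /choice[N NP] k : exists N, forall n,
    exists2 i, (i < N)%N & D n i < k.+1%:R^-1.
  by apply: tD; rewrite invr_gt0.
pose code k w := [seq Num.floor (x (iter i phi w) / d) | i <- iota 0 (N k)].
pose C (ks : nat * seq int) : set T := [set w | code ks.1 w = ks.2 /\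
  forall n i, D n i < ks.1.+1%:R^-1 ->
    `|x (iter n phi w) - x (iter i phi w)| <= d].
exists (fun j => if unpickle j is Some ks then C ks else set0).
  move=> w; have [d' d'0 dP] := eD w _ d0.
  have [k _ kd] := near_infty_natSinv_lt (PosNum d'0).
  exists (pickle (k, code k w)); rewrite pickleK; split=> // n i Dni.
  by apply/dP/(lt_trans Dni); exact: (kd _ (leqnn _)).
move=> j w w' n; case: unpickle => // -[k s]; rewrite /C/=.
move=> [<- wP] [cw' w'P].
have [i iN Dni] := NP k n.
have fl : Num.floor (x (iter i phi w) / d) = Num.floor (x (iter i phi w') / d).
  have := congr1 (fun s => nth 0 s i) cw'.
  by rewrite !(nth_map 0%N) ?size_iota// nth_iota.
have : `|x (iter i phi w) - x (iter i phi w')| <= d.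
  have := floor_itv (x (iter i phi w) / d).
  have := floor_itv (x (iter i phi w') / d).
  rewrite fl !intrD !ler_pdivlMr// !ltr_pdivrMr// => /andP[? ?] /andP[? ?].
  by rewrite ler_norml; apply/andP; split; lra.
have := wP _ _ Dni; have := w'P _ _ Dni; rewrite !ler_norml.
move=> /andP[? ?] /andP[? ?] /andP[? ?].
by apply/andP; split; lra.
Qed.

End small_oscillation.

(** * Minimal sets and the enveloping semigroup *)

Section minimal_sets.
Context {T : topologicalType} (f : T -> T).

(** Zorn's lemma in the form for unions of chains is applied to the sets [B] removed from [A]: a
    maximal removed set leaves a minimal remainder. Compactness keeps the remainder of a chain
    nonempty. *)
Lemma exists_minimal_set (A : set T) : compact [set: T] ->
  closed_invariant f A -> exists2 m, minimal_set f m & m `<=` A.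
Proof.
move=> cT [A0 cA fA].
pose P B := closed_invariant f (A `&` ~` B).
have [F FP Ftot|B [PB Bmax]] := @Zorn_bigcup T P.
  have [[B0 FB0]|F0] := pselect (F !=set0); last first.
    rewrite (_ : bigcup _ _ = set0) ?/P ?setC0 ?setIT//.
    by rewrite -subset0 => w [B FB _]; apply: F0; exists B.
  have AE : A `&` ~` (\bigcup_(B in F) B) = \bigcap_(B in F) (A `&` ~` B).
    rewrite setC_bigcup; apply/seteqP; split=> [w [Aw wF] B FB|w wF].
      by split=> //; exact: wF.
    by split=> [|B FB]; [case: (wF _ FB0)|case: (wF _ FB)].
  rewrite /P AE; split.
  - have FF : ProperFilter (filter_from F (fun B => A `&` ~` B)).
      apply: filter_from_proper; last by move=> B /FP[].
      apply: filter_from_filter; first by exists B0.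
      move=> B C FB FC; have [BC|CB] := Ftot _ _ FB FC.
        by exists C => // w [Aw Cw]; split; split=> // /BC.
      by exists B => // w [Aw Cw]; split; split=> // /CB.
    have [|p [_ clp]] := cT _ FF; first by exists B0.
    exists p => B FB; have [_ cB _] := FP _ FB.
    by apply: cB => U pU; apply: clp => //; exists B.
  - by apply: closed_bigI => B FB; have [] := FP _ FB.
  - move=> _ [w wF <-] B FB; have [_ _] := FP _ FB; apply.
    by exists w => //; exact: wF.
exists (A `&` ~` B); last exact: subIsetl.
split=> // m' [m'0 cm' fm'] m'B; apply/seteqP; split=> //.
have m'E : A `&` ~` (~` m' `|` B) = m'.
  rewrite setCU setCK; apply/seteqP; split=> [w [_ []]//|w m'w].
  by have [Aw Bw] := m'B _ m'w.
move=> w [Aw Bw]; apply: contrapT => m'w.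
apply: (Bmax (~` m' `|` B)); last by rewrite /P m'E.
split; first exact: subsetUr.
by move=> /(_ w) wB; apply: Bw; apply: wB; left.
Qed.

(** A closed invariant subset of the image pulls back to a closed invariant subset of [M], which is
    all of [M]. *)
Lemma minimal_set_image (S : topologicalType) (g : S -> S) (pi : T -> S)
    (M : set T) : compact [set: T] -> hausdorff_space S -> continuous pi ->
  (forall w, pi (f w) = g (pi w)) -> minimal_set f M ->
  minimal_set g (pi @` M).
Proof.
move=> cT hS cpi pif [[[p Mp] cM fM] Mmin]; split.
  split; first by exists (pi p), p.
  - apply: compact_closed => //; apply: continuous_compact.
      exact: continuous_subspaceT.
    exact: subclosed_compact cM cT _.
  - by move=> _ [_ [w Mw <-] <-]; exists (f w); [apply: fM; exists w|].
move=> m' [[y m'y] cm' gm'] m'M; apply/seteqP; split=> // _ [w Mw <-].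
have ME : M `&` pi @^-1` m' = M.
  apply: Mmin; last exact: subIsetl.
  split.
  - by have [v Mv piv] := m'M _ m'y; exists v; split=> //=; rewrite piv.
  - by apply: closedI => //; apply: closed_comp => // v _; exact: cpi.
  - move=> _ [v [Mv m'v] <-]; split; first by apply: fM; exists v.
    by rewrite /= pif; apply: gm'; exists (pi v).
by move: Mw; rewrite -ME => -[].
Qed.

Lemma minimal_set_disjoint (m m' : set T) : minimal_set f m ->
  minimal_set f m' -> m <> m' -> m `&` m' = set0.
Proof.
move=> [[m0 cm fm] mmin] [[m'0 cm' fm'] m'min] mm'.
apply: contrapT => /eqP/set0P mm'0; apply: mm'.
have inv : closed_invariant f (m `&` m').
  split=> //; first exact: closedI.
  by move=> _ [w [mw m'w] <-]; split; [apply: fm|apply: fm']; exists w.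
by rewrite -(mmin _ inv (@subIsetl _ _ _)) -{2}(m'min _ inv (@subIsetr _ _ _)).
Qed.

Lemma closed_invariant_iter (m : set T) (n : nat) (w : T) :
  closed_invariant f m -> m w -> m (iter n f w).
Proof.
by move=> [_ _ fm] mw; elim: n => //= n IH; apply: fm; exists (iter n f w).
Qed.

Hypothesis cf : continuous f.

Lemma continuous_iter n : continuous (iter n f).
Proof.
elim: n => [|n IH] w /=; first exact: cvg_id.
by apply: continuous_comp; [exact: IH|exact: cf].
Qed.

Lemma closed_invariant_orbit_closure w : closed_invariant f (orbit_closure f w).
Proof.
split.
- by exists w; apply: subset_closure; exists 0%N.
- exact: closed_closure.
- move=> _ [v wv <-] U /cf/wv[_ [[n _ <-] Un]].
  by exists (iter n.+1 f w); split=> //; exists n.+1.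
Qed.

Lemma orbit_closure_sub (m : set T) w : closed_invariant f m -> m w ->
  orbit_closure f w `<=` m.
Proof.
move=> mi mw; have [_ cm _] := mi; rewrite [X in _ `<=` X]((closure_id m).1 cm).
by apply: closure_subset => _ [n _ <-]; exact: closed_invariant_iter.
Qed.

End minimal_sets.

Section enveloping_semigroup_theory.
Context {R : realType} {Omega : topologicalType} (phi : Omega -> Omega).
Hypothesis phi_cont : continuous phi.
Hypothesis Omega_compact : compact [set: Omega].
Notation PT := {ptws Omega -> Omega}.
Notation E := (enveloping_semigroup phi).

Lemma continuous_eval w : continuous (fun p : PT => p w).
Proof. exact: (@proj_continuous Omega (fun=> Omega) w). Qed.

Lemma continuous_postcomp : continuous ((fun p => phi \o p) : PT -> PT).
Proof.
move=> p.
have FF := @fmap_filter _ _ (fun q : PT => phi \o q : PT) _ (nbhs_filter p).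
apply/(@cvg_sup _ _ _ _ _ FF) => w U.
rewrite (@nbhsE (initial_topology (fun q : PT => q w))).
move=> [B [[C oC <-] Bp]] /filterS; apply.
have : nbhs p ((fun q : PT => phi (q w)) @^-1` C).
  apply: (@continuous_comp _ _ _ (fun q : PT => q w) phi p).
  - exact: continuous_eval.
  - exact: phi_cont.
  - exact: open_nbhs_nbhs.
by [].
Qed.

Lemma compact_ptws : compact [set: PT].
Proof.
have := @tychonoff Omega (fun=> Omega) (fun=> setT) (fun=> Omega_compact).
by congr compact; apply/seteqP; split.
Qed.

Lemma closed_invariant_enveloping :
  closed_invariant (fun p : PT => phi \o p : PT) E.
Proof.
split.
- by exists id; apply: subset_closure; exists 0%N.
- exact: closed_closure.
- move=> _ [p Ep <-] U /continuous_postcomp/Ep[_ [[n _ <-] Un]].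
  by exists (iter n.+1 phi); split=> //; exists n.+1.
Qed.

Lemma enveloping_orbit_closure p w : E p -> orbit_closure phi w (p w).
Proof.
move=> Ep U /(continuous_eval (w := w))/Ep[_ [[n _ <-] Un]].
by exists (iter n phi w); split=> //; exists n.
Qed.

(* A point of a minimal left ideal of E sends every point of the trajectory
   closure into a minimal set. *)
Lemma enveloping_minimal w m : hausdorff_space Omega ->
  (forall m', minimal_set phi m' -> m' `<=` orbit_closure phi w -> m' = m) ->
  exists2 p : PT, E p & forall v, orbit_closure phi w v -> m (p v).
Proof.
move=> hO mu.
have [M Mmin ME] := exists_minimal_set compact_ptws closed_invariant_enveloping.
have [[[p Mp] _ _] _] := Mmin.
exists p => [|v wv]; first exact: ME.
(* Evaluation at [v] intertwines postcomposition by [phi] with [phi], so the image of [M] is a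
   minimal set in the trajectory closure of [w]. As [M] does not depend on [v], one [p] serves all
   [v]. *)
have -> : m = (fun q : PT => q v) @` M.
  apply/esym/mu.
    exact: (minimal_set_image compact_ptws hO (@continuous_eval v) _ Mmin).
  move=> _ [q Mq <-].
  apply: (orbit_closure_sub (closed_invariant_orbit_closure phi_cont w) wv).
  exact/enveloping_orbit_closure/ME.
by exists p.
Qed.

(** * Consequences of a metric on the enveloping semigroup *)

Section ordinary.
Variable d : set_type E -> set_type E -> R.
Hypothesis d_sym : forall p q, d p q = d q p.
Hypothesis d_tri : forall p q r, d p r <= d p q + d q r.
Hypothesis d_nbhs : forall p (A : set (set_type E)),
  nbhs p A <-> exists2 e : R, 0 < e & [set q | d p q < e] `<=` A.

Let e_ n : set_type E :=
  SigSub (mem_set (subset_closure (imageT (fun n => iter n phi : PT) n))).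

Let d_ball p (e : R) : 0 < e -> exists2 B : set PT, nbhs (set_val p) B &
  forall q, B (set_val q) -> d p q < e.
Proof.
move=> e0; have : nbhs p [set q | d p q < e] by apply/d_nbhs; exists e.
rewrite nbhsE => -[B [[C oC <-] Cp] CB].
by exists C; [exact: open_nbhs_nbhs|move=> q Cq; exact: CB].
Qed.

Let d_dense p (e : R) : 0 < e -> exists n, d p (e_ n) < e.
Proof.
move=> /(d_ball p)[B pB Bd]; have Ep : E (set_val p) by exact: set_valP.
by have [_ [[n _ <-] Bn]] := Ep _ pB; exists n; exact: Bd.
Qed.

Let d_cluster (n : nat -> nat) : exists p, forall (e : R) N, 0 < e ->
  exists2 k, (N <= k)%N & d p (e_ (n k)) < e.
Proof.
have cE : compact E.
  by apply: subclosed_compact compact_ptws _ => //; exact: closed_closure.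
have [p Ep clp] := compact_seq_cluster cE (fun k => set_valP (e_ (n k))).
exists (SigSub (mem_set Ep)) => e N /(d_ball (SigSub (mem_set Ep)))[B pB Bd].
by have [k Nk Bk] := clp B N pB; exists k => //; exact: Bd.
Qed.

Let d_eval p w (x : Omega -> R) (e : R) : continuous x -> 0 < e ->
  exists2 e' : R, 0 < e' & forall q, d p q < e' ->
    `|x (set_val p w) - x (set_val q w)| < e.
Proof.
move=> cx e0.
have : nbhs p [set q | `|x (set_val p w) - x (set_val q w)| < e].
  have : continuous (fun q : set_type E => x (set_val q w)).
    move=> q.
    apply: (@continuous_comp _ _ _ (fun q : set_type E => set_val q w) x).
      apply: (@continuous_comp _ _ _ set_val (fun q : PT => q w)).
        exact: (@initial_continuous (set_type E) PT set_val).
      exact: continuous_eval.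
    exact: cx.
  by move=> /(_ p)/cvgrPdist_lt/(_ e e0).
by move=> /d_nbhs[e' e'0 e'P]; exists e' => // q /e'P.
Qed.

Let D n k := d (e_ n) (e_ k).

Let D_totally_bounded (e : R) : 0 < e ->
  exists N, forall n, exists2 k, (k < N)%N & D n k < e.
Proof.
move=> e0; apply: contrapT => /forallNP nN.
have /choice[n nP] N : exists n, forall k, (k < N)%N -> e <= D n k.
  have /existsNP[n nP] := nN N; exists n => k kN.
  by rewrite leNgt; apply/negP => Dnk; apply: nP; exists k.
have [p clp] := d_cluster n; have e2 : 0 < e / 2 by rewrite divr_gt0.
(* The index [l] is taken beyond the value [n k], not beyond [k], because [n l] is separated from
   all numbers below [l]. *)
have [k _ pk] := clp _ 0%N e2; have [l kl pl] := clp _ (n k).+1 e2.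
have := nP _ _ kl; have := d_tri (e_ (n l)) p (e_ (n k)).
by rewrite (d_sym _ p) /D; lra.
Qed.

(** Evaluating at [w] and applying [x] is continuous on the compact metric space [E], hence
    uniformly continuous. *)
Let D_equicontinuous (x : Omega -> R) w (e : R) : continuous x -> 0 < e ->
  exists2 e' : R, 0 < e' & forall n k, D n k < e' ->
    `|x (iter n phi w) - x (iter k phi w)| <= e.
Proof.
move=> cx e0; apply: contrapT => nN.
have /choice[nk nkP] j : exists nk, D nk.1 nk.2 < j.+1%:R^-1 /\
    e < `|x (iter nk.1 phi w) - x (iter nk.2 phi w)|.
  apply: contrapT => /forallNP nk; apply: nN; exists j.+1%:R^-1.
    by rewrite invr_gt0 ltr0Sn.
  move=> n k Dnk; rewrite leNgt; apply/negP => xnk.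
  by apply: (nk (n, k)).
have [p clp] := d_cluster (fst \o nk).
have e2 : 0 < e / 2 by rewrite divr_gt0.
have [e' e'0 e'P] := d_eval p w cx e2.
have e'2 : 0 < e' / 2 by rewrite divr_gt0.
have [N _ NP] := near_infty_natSinv_lt (PosNum e'2).
have [j Nj /= pj] := clp _ N e'2; have [Dj] := nkP j.
have {}Dj : d (e_ (nk j).1) (e_ (nk j).2) < e' / 2 := lt_trans Dj (NP _ Nj).
have : d p (e_ (nk j).2) < e'.
  by have := d_tri p (e_ (nk j).1) (e_ (nk j).2); lra.
have pj' : d p (e_ (nk j).1) < e' by lra.
move=> /e'P; have := e'P _ pj' => /=.
move: (x (iter _ _ _)) (x (iter _ _ _)) (x _) => u v y.
rewrite !ltr_norml => /andP[? ?] /andP[? ?].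
by rewrite ltNge; apply/negP; rewrite negbK ler_norml; apply/andP; split; lra.
Qed.

(** In a metric space a point of a closure is the limit of a sequence, which makes sequential
    bounded convergence available for [p]. *)
Lemma metrizable_enveloping_sequence p : E p -> exists n : nat -> nat,
  forall w (x : Omega -> R), continuous x ->
    x (iter (n k) phi w) @[k --> \oo] --> x (p w).
Proof.
move=> Ep; pose p' : set_type E := SigSub (mem_set Ep).
have /choice[n nP] k : exists n, d p' (e_ n) < k.+1%:R^-1.
  by apply: d_dense; rewrite invr_gt0 ltr0Sn.
exists n => w x cx; apply/cvgrPdist_lt => e e0.
have [e' e'0 e'P] := d_eval p' w cx e0.
have [N _ NP] := near_infty_natSinv_lt (PosNum e'0).
exists N => // k Nk; apply: (e'P (e_ (n k))).
exact: lt_trans (nP k) (NP _ Nk).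
Qed.

Lemma metrizable_enveloping_pseudometric : exists D : nat -> nat -> R,
  (forall e : R, 0 < e -> exists N, forall n, exists2 k, (k < N)%N & D n k < e) /\
  forall (x : Omega -> R) w (e : R), continuous x -> 0 < e ->
    exists2 e' : R, 0 < e' & forall n k, D n k < e' ->
      `|x (iter n phi w) - x (iter k phi w)| <= e.
Proof.
exists D; split; first exact: D_totally_bounded.
by move=> x w e; exact: D_equicontinuous.
Qed.

End ordinary.
End enveloping_semigroup_theory.

Lemma metrizable_hausdorff (R : realType) (T : topologicalType) :
  metrizable R T -> hausdorff_space T.
Proof.
move=> [d [d0 d_eq d_sym d_tri d_nbhs]] x y clxy; apply: d_eq.
apply/eqP; rewrite eq_le; apply/andP; split; last first.
  by have := d_tri x y x; rewrite (d_sym y x) d0; lra.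
rewrite leNgt; apply/negP => dxy.
have d2 : 0 < d x y / 2 by rewrite divr_gt0.
have [||z [/= xz yz]] :=
    clxy [set z | d x z < d x y / 2] [set z | d y z < d x y / 2].
- by apply/d_nbhs; exists (d x y / 2).
- by apply/d_nbhs; exists (d x y / 2).
- by have := d_tri x z y; rewrite (d_sym z y); lra.
Qed.

(** * Averages along trajectories *)

(** Otherwise regularity gives decreasing open sets that meet [m], the closure of each next one
    avoiding the next [C j]. Points of [m] chosen in them cluster at a point of [m] outside every
    [C j]. *)
Lemma compact_hausdorff_baire (T : topologicalType) (m : set T)
    (C : nat -> set T) :
  compact [set: T] -> hausdorff_space T -> closed m -> m !=set0 ->
  (forall j, closed (C j)) -> (forall w, m w -> exists j, C j w) ->
  exists j V, [/\ open V, V `&` m !=set0 & V `&` m `<=` C j].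
Proof.
move=> cT hT cm [w0 mw0] cC mC; apply: contrapT => nV.
pose good (V : set T) := open V /\ V `&` m !=set0.
have step (jV : nat * set T) : exists V', good jV.2 ->
    good V' /\ closure V' `<=` jV.2 `&` ~` C jV.1.
  case: jV => j V /=; have [[oV Vm]|nG] := pselect (good V); last by exists V.
  have [w [[Vw mw] Cw]] : exists w, (V `&` m) w /\ ~ C j w.
    apply: contrapT => /forallNP nw; apply: nV; exists j, V; split=> // w Vmw.
    by apply: contrapT => Cw; apply: (nw w).
  have wVC : nbhs w (V `&` ~` C j).
    apply: open_nbhs_nbhs; split=> //; apply: openI => //.
    exact: closed_openC.
  have [U wU UVC] := compact_regular hT cT filterT wVC.
  exists U^° => _; split.
    split; first exact: open_interior.
    by exists w; split=> //; exact: nbhs_singleton (nbhs_interior wU).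
  by apply: subset_trans UVC; apply: closure_subset; exact: interior_subset.
have [f fP] := choice step.
pose V := fix V n := if n is n'.+1 then f (n', V n') else setT.
have Vgood n : good (V n).
  elim: n => [|n IH]; last by have [] := fP (n, V n) IH.
  by split; [exact: openT|exists w0].
have VS n : closure (V n.+1) `<=` V n `&` ~` C n.
  by have [] := fP (n, V n) (Vgood n).
have Vle n k : (n <= k)%N -> V k `<=` V n.
  elim: k => [|k IH]; first by rewrite leqn0 => /eqP->.
  rewrite leq_eqVlt => /predU1P[-> //|/IH kn w Vw].
  by apply: kn; have [] := VS k _ (subset_closure Vw).
have /choice[w wP] n : exists w, (V n `&` m) w.
  by have [_ [w ?]] := Vgood n; exists w.
have cmc : compact m by exact: subclosed_compact cm cT _.
have [p mp clp] := compact_seq_cluster cmc (fun n => (wP n).2).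
have [j Cj] := mC _ mp.
have : closure (V j.+1) p.
  move=> U pU; have [k jk Uk] := clp U j.+1 pU.
  by exists (w k); split=> //; apply: Vle jk _ (wP k).1.
by move=> /VS[].
Qed.

(** * Limits along filters and ultrafilters *)

Section filters.
Context {R : realType} {I : Type}.

Lemma cvg_norm_le (F : set_system I) (u : I -> R) (l a : R) :
  ProperFilter F -> (forall i, `|u i| <= a) -> u @ F --> l -> `|l| <= a.
Proof.
move=> FF ua /cvgrPdist_le ul; apply/ler_addgt0Pl => e e0.
have [i li] := filter_ex (ul e e0).
by rewrite -(subrK (u i) l) (le_trans (ler_normD _ _))// lerD.
Qed.

Lemma cvg_unique_real (F : set_system I) (u : I -> R) (l l' : R) :
  ProperFilter F -> u @ F --> l -> u @ F --> l' -> l = l'.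
Proof. by move=> FF; exact: cvg_unique. Qed.

Lemma ultra_bounded_cvg (U : set_system I) (u : I -> R) (a : R) :
  UltraFilter U -> (forall i, `|u i| <= a) -> exists l : R, u @ U --> l.
Proof.
move=> UU ua; have UP : ProperFilter U by exact: ultra_proper.
have [|l [_ cll]] := @segment_compact R (- a) a (u @ U) _.
  by apply: nearW => i /=; rewrite in_itv/= -ler_norml.
exists l => V lV; have [//|nV] := in_ultra_setVsetC (u @^-1` V) UU.
exfalso; have uV : U (u @^-1` (u @` (~` (u @^-1` V)))).
  by apply: filterS nV => i Vi; exists i.
have [r [[i nVi <-] Vi]] := cll _ _ uV lV.
exact: nVi.
Qed.

Lemma cvg_ultra (T : topologicalType) (F : set_system I) (u : I -> T) (l : T) :
  ProperFilter F ->
  (forall U, UltraFilter U -> F `<=` U -> u @ U --> l) -> u @ F --> l.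
Proof.
move=> FF Ul V lV; apply: contrapT => nV.
pose G := filter_from F (fun S => S `&` ~` (u @^-1` V)).
have GF : ProperFilter G.
  apply: filter_from_proper; last first.
    move=> S FS; apply/set0P/negP => /eqP S0; apply: nV.
    suff : F (u @^-1` V) by [].
    by apply: filterS FS; rewrite -[_ @^-1` _]setCK; apply/disjoints_subset.
  apply: filter_from_filter; first by exists setT; exact: filterT.
  move=> S S' FS FS'; exists (S `&` S'); first exact: filterI.
  by move=> i [[Si S'i] Vi].
have [U [UU GU]] := ultraFilterLemma GF.
have UP : ProperFilter U by exact: ultra_proper.
have FU : F `<=` U.
  by move=> S FS; apply: GU; exists S => // i [].
have UV : U (u @^-1` V) by exact: Ul lV.
have UnV : U (~` (u @^-1` V)).
  by apply: GU; exists setT => [|i []//]; exact: filterT.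
have UI : U (u @^-1` V `&` ~` (u @^-1` V)) by exact: filterI.
by have [i []] := filter_ex UI.
Qed.

End filters.

(** * Convex combinations of iterates acting on functions *)

Section orbit_averages.
Context {R : realType} {T : topologicalType} (phi : T -> T).

(** The counterpart of [G0] on the side of functions, with real coefficients. *)
Definition orbit_average (A : (T -> R) -> T -> R) : Prop :=
  exists n (c : 'I_n -> R) (k : 'I_n -> nat),
    [/\ forall j, 0 <= c j, \sum_(j < n) c j = 1
      & forall g w, A g w = \sum_(j < n) c j * g (iter (k j) phi w)].

Variable A : (T -> R) -> T -> R.
Hypothesis avgA : orbit_average A.

Lemma orbit_average_continuous g : continuous phi -> continuous g ->
  continuous (A g).
Proof.
move=> cphi cg; have [n [c [k [_ _ AE]]]] := avgA.
have -> : A g = fun w => \sum_(j < n) c j * g (iter (k j) phi w).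
  by apply/funext => w.
apply: continuous_big => [|j _ w]; first exact: add_continuous.
apply: cvgM; first exact: cvg_cst.
by apply: (@continuous_comp _ _ _ _ g); [exact: continuous_iter|exact: cg].
Qed.

Lemma orbit_averageD f g w : A (f \+ g) w = A f w + A g w.
Proof.
have [n [c [k [_ _ AE]]]] := avgA.
by rewrite !AE -big_split; apply: eq_bigr => j _; rewrite mulrDr.
Qed.

Lemma orbit_averageZ a f w : A (a \*o f) w = a * A f w.
Proof.
have [n [c [k [_ _ AE]]]] := avgA.
by rewrite !AE mulr_sumr; apply: eq_bigr => j _; rewrite mulrCA.
Qed.

Lemma orbit_average_cst a w : A (cst a) w = a.
Proof.
by have [n [c [k [_ c1 AE]]]] := avgA; rewrite AE -mulr_suml c1 mul1r.
Qed.

Lemma orbit_average_comp f w : A f (phi w) = A (f \o phi) w.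
Proof.
have [n [c [k [_ _ AE]]]] := avgA.
by rewrite !AE; apply: eq_bigr => j _; rewrite /= -iterSr.
Qed.

Lemma orbit_average_bound f w a :
  (forall n, `|f (iter n phi w)| <= a) -> `|A f w| <= a.
Proof.
move=> fa; have [n [c [k [c0 c1 AE]]]] := avgA.
rewrite AE (le_trans (ler_norm_sum _ _ _))// -[leRHS]mul1r -c1 mulr_suml.
by apply: ler_sum => j _; rewrite normrM ger0_norm// ler_wpM2l.
Qed.

Lemma orbit_average_osc f w w' a :
  (forall n, `|f (iter n phi w) - f (iter n phi w')| <= a) ->
  `|A f w - A f w'| <= a.
Proof.
move=> fa; have [n [c [k [c0 c1 AE]]]] := avgA.
rewrite !AE -sumrB (le_trans (ler_norm_sum _ _ _))// -[leRHS]mul1r -c1 mulr_suml.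
by apply: ler_sum => j _; rewrite -mulrBr normrM ger0_norm// ler_wpM2l.
Qed.

Lemma orbit_average_invariant m b (mu : (T -> R) -> R) f :
  continuous phi -> bounded_on m b mu ->
  (forall g, continuous g -> mu (g \o phi) = mu g) -> continuous f ->
  mu (A f) = mu f.
Proof.
move=> cphi [_ muD muZ _] mui cf; have [n [c [k [c0 c1 AE]]]] := avgA.
have cfk i : continuous (fun w => f (iter i phi w)).
  by move=> w; apply: continuous_comp; [exact: continuous_iter|exact: cf].
have muk i : mu (fun w => f (iter i phi w)) = mu f.
  elim: i => // i <-; rewrite -[RHS]mui//; congr mu; apply/funext => w /=.
  by rewrite -iterSr.
have mu0 : mu (cst 0) = 0.
  rewrite -[RHS](mul0r (mu (cst 0))) -muZ; last exact: cst_continuous.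
  by congr mu; apply/funext => w /=; rewrite mul0r.
have -> : A f = fun w => \sum_(j < n) c j * f (iter (k j) phi w).
  by apply/funext => w.
rewrite -[RHS]mul1r -c1 mulr_suml.
(* Continuity of the partial sums is carried along in the induction because additivity of [mu] is
   assumed only for continuous functions. *)
suff [] : continuous (fun w => \sum_(j < n) c j * f (iter (k j) phi w)) /\
    mu (fun w => \sum_(j < n) c j * f (iter (k j) phi w)) =
    \sum_(j < n) c j * mu f by [].
elim: (index_enum _) => [|j s [cs mus]].
  rewrite big_nil; under eq_fun do rewrite big_nil; split=> //.
  exact: cst_continuous.
rewrite big_cons; under eq_fun do rewrite big_cons.
have ccj : continuous (c j \*o (fun w => f (iter (k j) phi w))).
  by move=> w; apply: cvgM; [exact: cvg_cst|exact: cfk].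
split; first by move=> w; apply: cvgD; [exact: ccj|exact: cs].
by rewrite -mus -(muk (k j)) -muZ// -muD.
Qed.

End orbit_averages.

(** * Convergence of ergodic averages of a real function *)

Section ergodic_averages.
Context {R : realType} {T : topologicalType} (phi : T -> T).
Hypothesis T_compact : compact [set: T].
Hypothesis T_hausdorff : hausdorff_space T.
Hypothesis phi_cont : continuous phi.

Let continuous_comp_iter (x : T -> R) n : continuous x ->
  continuous (fun w => x (iter n phi w)).
Proof.
by move=> cx w; apply: continuous_comp; [exact: continuous_iter|exact: cx].
Qed.

Lemma continuous_compact_bounded (x : T -> R) : continuous x ->
  exists a, forall w, `|x w| <= a.
Proof.
move=> cx; have : compact (x @` setT).
  by apply: continuous_compact => //; exact: continuous_subspaceT.
move=> /compact_bounded[M [_ /(_ (M + 1))]]; rewrite ltrDl ltr01 => /(_ isT) xM.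
by exists (M + 1) => w; apply: xM; exists w.
Qed.

Lemma closure_oscillation (x : T -> R) (C : set T) (e : R) : continuous x ->
  (forall w w', C w -> C w' -> `|x w - x w'| <= e) ->
  forall w w', closure C w -> closure C w' -> `|x w - x w'| <= e.
Proof.
move=> cx Ce.
have cl (y : T -> R) : continuous y -> (forall w, C w -> y w <= e) ->
    forall w, closure C w -> y w <= e.
  move=> cy Cy; have cle : closed (y @^-1` [set r | r <= e]).
    by apply: closed_comp; [move=> w _; exact: cy|exact: closed_le].
  move=> w Cw; suff : (y @^-1` [set r | r <= e]) w by [].
  by apply: cle; apply: closure_subset Cw => v /Cy.
move=> w w' Cw Cw'; move: w' Cw'; apply: (cl _).
  move=> v; apply: cvg_norm; apply: cvgB; [exact: cvg_cst|exact: cx].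
move=> w' Cw'; move: w Cw; apply: cl => [|w Cw]; last exact: Ce.
by move=> v; apply: cvg_norm; apply: cvgB; [exact: cx|exact: cvg_cst].
Qed.

(** Baire's theorem on [m] is applied to the closures of the [C j]; by continuity, closing a set
    does not increase the oscillation. *)
Lemma minimal_set_small_open (m : set T) (x : T -> R) (e : R)
    (C : nat -> set T) : minimal_set phi m -> continuous x ->
  (forall w, exists j, C j w) ->
  (forall j w w' n, C j w -> C j w' ->
     `|x (iter n phi w) - x (iter n phi w')| <= e) ->
  exists V, [/\ open V, V `&` m !=set0 &
    forall w w' n, (V `&` m) w -> (V `&` m) w' ->
      `|x (iter n phi w) - x (iter n phi w')| <= e].
Proof.
move=> [[m0 cm _] _] cx covC oscC.
have [|w _|j [V [oV Vm VC]]] :=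
    compact_hausdorff_baire (C := fun j => closure (C j)) T_compact T_hausdorff
      cm m0.
- by move=> j; exact: closed_closure.
- by have [j Cj] := covC w; exists j; exact: subset_closure.
exists V; split=> // w w' n /VC Cw /VC Cw'.
apply: (closure_oscillation (continuous_comp_iter cx) _ Cw Cw').
by move=> v v'; exact: oscC.
Qed.

(** Every trajectory in a minimal set is dense in it. *)
Lemma minimal_set_visit (m V : set T) w : minimal_set phi m -> open V ->
  V `&` m !=set0 -> m w -> exists k, V (iter k phi w).
Proof.
move=> [mi mmin] oV [v [Vv mv]] mw.
have oE : orbit_closure phi w = m.
  by apply: mmin; [exact: closed_invariant_orbit_closure|exact: orbit_closure_sub].
move: mv; rewrite -oE => /(_ V (open_nbhs_nbhs (conj oV Vv)))[_ [[k _ <-] Vk]].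
by exists k.
Qed.

(** If [y] vanishes on [m], the functions [y (iter (n k) phi w)] tend to [y (p w) = 0] on [K], so
    [mu y = 0] by bounded convergence and invariance. Hence only values on [m] matter, although the
    given bound refers to [K]. *)
Lemma bounded_on_support (K m : set T) (b : R) mu (p : T -> T) (n : nat -> nat) :
  compact K -> bounded_on K b mu ->
  (forall g, continuous g -> mu (g \o phi) = mu g) ->
  (forall w, K w -> m (p w)) ->
  (forall w (x : T -> R), continuous x ->
     x (iter (n k) phi w) @[k --> \oo] --> x (p w)) ->
  bounded_on m b mu.
Proof.
move=> cK mub mui pm np; have [b0 muD muZ bmu] := mub.
have mu0 y : continuous y -> (forall w, m w -> y w = 0) -> mu y = 0.
  move=> cy y0; have [a ya] := continuous_compact_bounded cy.
  have muk i : mu (fun w => y (iter i phi w)) = mu y.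
    elim: i => // i <-; rewrite -[RHS]mui//; last exact: continuous_comp_iter.
    by congr mu; apply/funext => w /=; rewrite -iterSr.
  have : mu (fun w => y (iter (n k) phi w)) @[k --> \oo] --> 0.
    apply: (@bounded_on_cvg0 _ _ _ _ _ mub cK
              (fun k w => y (iter (n k) phi w)) a).
    - by move=> k; exact: continuous_comp_iter.
    - by move=> k w _; exact: ya.
    - by move=> w Kw; rewrite -(y0 _ (pm _ Kw)); exact: np.
  by under eq_fun do rewrite muk; apply: cvg_unique_real; exact: cvg_cst.
split=> // g a cg a0 ga.
(* Truncation at level [a] changes [g] only off [m], hence does not change [mu g], and makes the
   bound hold everywhere. *)
pose q w := Num.max (- a) (Num.min a (g w)).
have cq : continuous q.
  by apply: (@clamp_continuous _ _ (cst a)) => //; exact: cst_continuous.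
have cgq : continuous (g \+ (\- q)).
  by move=> w; apply: cvgB; [exact: cg|exact: cq].
have -> : g = (g \+ (\- q)) \+ q by apply/funext => w; rewrite /= subrK.
rewrite muD// mu0 ?add0r//.
  by apply: bmu => // w _; exact: clamp_le.
move=> w mw; rewrite /= /q.
have := ga _ mw; rewrite ler_norml => /andP[l1 l2].
by rewrite (min_idPr l2) (max_idPr l1) subrr.
Qed.

Variables (I : Type) (F : set_system I) (A : I -> (T -> R) -> T -> R).
Hypothesis FF : ProperFilter F.
Hypothesis avgA : forall i, orbit_average phi (A i).
Hypothesis ergA : forall g w, continuous g ->
  A i g w - A i (g \o phi) w @[i --> F] --> 0.

Let phi_comp (g : T -> R) : continuous g -> continuous (g \o phi).
Proof. by move=> cg w; apply: continuous_comp; [exact: phi_cont|exact: cg]. Qed.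

(** Boundedness makes the averages of every continuous function converge along [U], and ergodicity
    makes the limit functional invariant. *)
Lemma invariant_ultralimit (U : set_system I) (w : T) :
  UltraFilter U -> F `<=` U -> exists lam : (T -> R) -> R,
  [/\ forall g, continuous g -> A i g w @[i --> U] --> lam g,
      bounded_on (orbit_closure phi w) 1 lam
    & forall g, continuous g -> lam (g \o phi) = lam g].
Proof.
move=> UU FU; have UP : ProperFilter U by exact: ultra_proper.
have /choice[lam lamP] (g : T -> R) :
    exists l : R, continuous g -> A i g w @[i --> U] --> l.
  have [cg|ncg] := pselect (continuous g); last by exists 0.
  have [a ga] := continuous_compact_bounded cg.
  have [|l lP] := @ultra_bounded_cvg R I U (fun i => A i g w) a UU.
    by move=> i; exact: (orbit_average_bound (avgA i)).
  by exists l.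
exists lam; split=> //.
  split=> //.
  - move=> f g cf cg; apply: (@cvg_unique_real _ _ U (fun i => A i (f \+ g) w)).
      by apply: lamP => v; apply: cvgD; [exact: cf|exact: cg].
    under eq_fun do rewrite (orbit_averageD (avgA _)).
    by apply: cvgD; exact: lamP.
  - move=> k f cf; apply: (@cvg_unique_real _ _ U (fun i => A i (k \*o f) w)).
      by apply: lamP => v; apply: cvgM; [exact: cvg_cst|exact: cf].
    under eq_fun do rewrite (orbit_averageZ (avgA _)).
    by apply: cvgM; [exact: cvg_cst|exact: lamP].
  - move=> f a cf a0 fa; rewrite mul1r.
    apply: (cvg_norm_le UP _ (lamP _ cf)) => i.
    apply: (orbit_average_bound (avgA i)) => n; apply: fa.
    by apply: subset_closure; exists n.
move=> g cg; apply/esym/subr0_eq.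
apply: (@cvg_unique_real _ _ U (fun i => A i g w - A i (g \o phi) w)).
  by apply: cvgB; apply: lamP => //; exact: phi_comp.
by apply: cvg_trans (ergA w cg); apply: cvg_app.
Qed.

Section one_observable.
Variable x : T -> R.
Hypothesis cx : continuous x.
Hypothesis small : forall e : R, 0 < e -> exists2 C : nat -> set T,
  (forall w, exists j, C j w) &
  forall j w w' n, C j w -> C j w' ->
    `|x (iter n phi w) - x (iter n phi w')| <= e.

(** The limit is invariant along trajectories by ergodicity. The trajectories of any two points of
    [m] enter a common open set of small oscillation, so their limits are arbitrarily close. *)
Lemma ultralimit_minimal_cst (U : set_system I) (m : set T) :
  UltraFilter U -> F `<=` U -> minimal_set phi m ->
  exists c : R, forall w, m w -> A i x w @[i --> U] --> c.
Proof.
move=> UU FU mmin; have [mi _] := mmin; have [[w0 mw0] _ _] := mi.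
have UP : ProperFilter U by exact: ultra_proper.
have /choice[g gP] w : exists l : R, A i x w @[i --> U] --> l.
  have [lam [lamP _ _]] := invariant_ultralimit w UU FU.
  by exists (lam x); exact: lamP.
have ginv k w : g (iter k phi w) = g w.
  elim: k => //= k <-; set v := iter k phi w.
  apply/esym/subr0_eq.
  apply: (@cvg_unique_real _ _ U (fun i => A i x v - A i (x \o phi) v)).
    under eq_fun do rewrite -(orbit_average_comp (avgA _)).
    by apply: cvgB; exact: gP.
  by apply: cvg_trans (ergA v cx); apply: cvg_app.
exists (g w0) => w mw; suff <- : g w = g w0 by exact: gP.
apply/subr0_eq/eqP; rewrite -normr_le0; apply/ler_addgt0Pl => e e0.
rewrite addr0; have [C covC oscC] := small e0.
have [V [oV Vm Vosc]] := minimal_set_small_open mmin cx covC oscC.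
have [k Vk] := minimal_set_visit mmin oV Vm mw.
have [l Vl] := minimal_set_visit mmin oV Vm mw0.
rewrite -(ginv k w) -(ginv l w0).
apply: (cvg_norm_le UP _ (cvgB (gP (iter k phi w)) (gP (iter l phi w0)))) => i.
apply: (orbit_average_osc (avgA i)) => n.
by apply: Vosc; split=> //; exact: closed_invariant_iter.
Qed.

(** The candidate [c] comes from one ultrafilter [U0]; every other ultrafilter [U] gives an
    invariant functional [lam] carried by [m]. By invariance [lam (A i x - c)] is constantly
    [lam x - c], while it tends to 0 along [U0], as [A i x] tends to [c] on [m]. *)
Lemma orbit_average_pointwise_cvg (w : T) (m : set T) (p : T -> T)
    (n : nat -> nat) :
  minimal_set phi m -> (forall v, orbit_closure phi w v -> m (p v)) ->
  (forall v (y : T -> R), continuous y ->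
     y (iter (n k) phi v) @[k --> \oo] --> y (p v)) ->
  exists c : R, A i x w @[i --> F] --> c.
Proof.
move=> mmin pm np; have [U0 [U0U FU0]] := ultraFilterLemma FF.
have U0P : ProperFilter U0 by exact: ultra_proper.
have [c cP] := ultralimit_minimal_cst U0U FU0 mmin.
exists c; apply: cvg_ultra => U UU FU.
have UP : ProperFilter U by exact: ultra_proper.
have [lam [lamP lamb lami]] := invariant_ultralimit w UU FU.
suff -> : c = lam x by exact: lamP.
have [[_ cm _] _] := mmin.
have ccl : compact (orbit_closure phi w).
  by apply: subclosed_compact T_compact _ => //; exact: closed_closure.
have cmc : compact m by apply: subclosed_compact T_compact _.
have lamm := bounded_on_support ccl lamb lami pm np.
have [_ lamD lamZ _] := lamm.
have cA i : continuous (A i x) by exact: (orbit_average_continuous (avgA i)).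
have lam1 : lam (cst (- c)) = - c.
  apply: (@cvg_unique_real _ _ U (fun i => A i (cst (- c)) w)).
    by apply: lamP; exact: cst_continuous.
  by under eq_fun do rewrite (orbit_average_cst (avgA _)); exact: cvg_cst.
have [a xa] := continuous_compact_bounded cx.
have : lam (A i x \+ cst (- c)) @[i --> U0] --> 0.
  apply: (bounded_on_cvg0_filter _ lamm cmc (a := a + `|c|)).
  - by move=> i v; apply: cvgD; [exact: cA|exact: cvg_cst].
  - move=> i v _; rewrite (le_trans (ler_normD _ _))//= normrN lerD2r.
    exact: (orbit_average_bound (avgA i)).
  - move=> e e0; have [C covC oscC] := small e0; exists C => // j v v' i Cv Cv'.
    rewrite /= opprD addrACA subrr addr0.
    by apply: (orbit_average_osc (avgA i)) => k; exact: oscC Cv Cv'.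
  - move=> v mv; rewrite -(subrr c).
    by apply: cvgB; [exact: cP|exact: cvg_cst].
have lamE i : lam (A i x \+ cst (- c)) = lam x - c.
  rewrite lamD//; last exact: cst_continuous.
  by rewrite lam1 (orbit_average_invariant (avgA i) phi_cont lamm lami cx).
under eq_fun do rewrite lamE.
move=> lam0; apply/esym/subr0_eq.
by apply: cvg_unique_real lam0; exact: cvg_cst.
Qed.

(** The pointwise limit [c] need not be continuous, so [mu] is not applied to it. Instead the
    differences of two averages tend to 0 along the product filter, which gives the Cauchy
    criterion. *)
Lemma orbit_average_functional_cvg (b : R) mu : bounded_on setT b mu ->
  (forall w, exists c : R, A i x w @[i --> F] --> c) ->
  cvg (mu (A i x) @[i --> F]).
Proof.
move=> mub /choice[c cP].
have cA i : continuous (A i x) by exact: (orbit_average_continuous (avgA i)).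
have [a xa] := continuous_compact_bounded cx.
have muE f g : continuous f -> continuous g -> mu (f \+ (\- g)) = mu f - mu g.
  move=> cf cg; have [_ muD _ _] := mub.
  rewrite muD ?(bounded_on_opp mub)//.
  by move=> w; apply: cvgN; exact: cg.
have : mu (A ij.1 x \+ (\- A ij.2 x)) @[ij --> (F, F)] --> 0.
  apply: (bounded_on_cvg0_filter _ mub T_compact (a := a + a)).
  - by move=> ij v; apply: cvgB; exact: cA.
  - move=> ij v _; rewrite (le_trans (ler_normD _ _))//= normrN.
    by apply: lerD; apply: (orbit_average_bound (avgA _)).
  - move=> e e0; have e2 : 0 < e / 2 by rewrite divr_gt0.
    have [C covC oscC] := small e2; exists C => // j v v' ij Cv Cv'.
    rewrite /= opprD opprK addrACA (le_trans (ler_normD _ _))// [leRHS]splitr.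
    rewrite [X in _ + `|X|]addrC lerD//; apply: (orbit_average_osc (avgA _)) => k.
      exact: oscC Cv Cv'.
    exact: oscC Cv' Cv.
  - move=> v _; rewrite -(subrr (c v)).
    apply: cvgB.
      exact: (@cvg_comp _ _ _ fst (fun i => A i x v) _ _ _ cvg_fst (cP v)).
    exact: (@cvg_comp _ _ _ snd (fun i => A i x v) _ _ _ cvg_snd (cP v)).
move=> mu0; apply: cauchy_cvg; apply/cauchy_ballP => e e0.
move/cvgrPdist_lt : mu0 => /(_ e e0)[[P Q] /= [FP FQ] PQ].
exists ((fun i => mu (A i x)) @` P, (fun i => mu (A i x)) @` Q).
  by split=> /=; [apply: filterS FP|apply: filterS FQ] => i Pi; exists i.
move=> [_ _] /= [[i Pi <-] [j Qj <-]].
by have /= := PQ (i, j) (conj Pi Qj); rewrite muE// sub0r normrN.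
Qed.

End one_observable.
End ergodic_averages.

Theorem ordinary_orbit_average_cvg (R : realType) (T : topologicalType)
    (phi : T -> T) (I : Type) (F : set_system I) (A : I -> (T -> R) -> T -> R)
    (x : T -> R) (b : R) (mu : (T -> R) -> R) :
  compact [set: T] -> hausdorff_space T -> continuous phi -> ordinary R phi ->
  (forall w, exists! m, minimal_set phi m /\ m `<=` orbit_closure phi w) ->
  ProperFilter F -> (forall i, orbit_average phi (A i)) ->
  (forall g w, continuous g -> A i g w - A i (g \o phi) w @[i --> F] --> 0) ->
  continuous x -> bounded_on setT b mu ->
  cvg (mu (A i x) @[i --> F]).
Proof.
move=> cT hT cphi [d [d0 d_eq d_sym d_tri d_nbhs]] mu1 FF avgA ergA cx mub.
have [D [Dtb Deq]] :=
  metrizable_enveloping_pseudometric cT d_sym d_tri d_nbhs.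
have small := countable_small_oscillation Dtb (fun w e => Deq x w e cx).
apply: (orbit_average_functional_cvg cT cphi FF avgA cx small mub) => w.
have [m [[mmin mw] muniq]] := mu1 w.
have [|p Ep pm] := @enveloping_minimal T phi cphi cT w m hT.
  by move=> m' m'min m'w; apply/esym/muniq.
have [n nP] := metrizable_enveloping_sequence d_nbhs Ep.
exact: (orbit_average_pointwise_cvg cT hT cphi FF avgA ergA cx small mmin pm nP).
Qed.

(** * Real and complex functionals *)

(* Real and complex scalars are treated together: a scalar z is
   iota (re z) + imag_unit * iota (im z), where im = 0 in the real case. *)
Section scalars.
Variables (R : realType) (K : numFieldType).

(** Additivity, real homogeneity and contraction are what real and imaginary parts share, so one set
    of lemmas covers both. *)
Definition real_part (iota : R -> K) (rho : K -> R) : Prop :=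
  [/\ forall z z', rho (z + z') = rho z + rho z',
      forall r z, rho (iota r * z) = r * rho z
    & forall z, iota `|rho z| <= `|z|].

Record scalar_structure := ScalarStructure {
  iota : {rmorphism R -> K};
  re : K -> R;
  im : K -> R;
  imag_unit : K;
  re_part : real_part iota re;
  im_part : real_part iota im;
  scalarE : forall z, z = iota (re z) + imag_unit * iota (im z);
  ge0_re : forall z, 0 <= z -> iota (re z) = z;
  iota_le : forall r s, (iota r <= iota s) = (r <= s);
  iota_norm : forall r, `|iota r| = iota `|r| }.

End scalars.

Lemma real_scalar_structure (R : realType) : scalar_structure R R.
Proof.
apply: (@ScalarStructure R R idfun id (fun=> 0) 0) => //.
- by split=> // *; rewrite ?addr0 ?mulr0 ?normr0 ?normr_ge0.
- by move=> z; rewrite mul0r addr0.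
Qed.

Lemma complex_scalar_structure (R : realType) : scalar_structure R R[i].
Proof.
apply: (@ScalarStructure R R[i] (real_complex R) (@complex.Re R) (@complex.Im R)
  'i%C).
- split=> [[a b] [c d]//|r [a b]/=|z]; first by rewrite mul0r subr0.
  exact: normc_ge_Re.
- split=> [[a b] [c d]//|r [a b]/=|z]; first by rewrite mul0r addr0.
  rewrite normc_def lecR -sqrtr_sqr ler_sqrt ?addr_ge0 ?sqr_ge0//.
  by rewrite lerDr sqr_ge0.
- exact: complexE.
- by move=> [a b]; rewrite lecE /= => /andP[/eqP-> _].
- exact: lecR.
- by move=> r; rewrite normc_def /= expr0n addr0 sqrtr_sqr.
Qed.

Lemma scalar_structureP (R : realType) (K : numFieldType) :
  K = (R : numFieldType) \/ K = (R[i] : numFieldType) ->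
  inhabited (scalar_structure R K).
Proof.
move=> [->|->]; first exact: (inhabits (real_scalar_structure R)).
exact: (inhabits (complex_scalar_structure R)).
Qed.

(** * Continuous functions, functionals and operators in [G0] *)

Section continuous_elements.
Variables (K : numFieldType) (Omega : topologicalType).

(** The default 0 for discontinuous [f] lets functions be passed without a continuity proof. *)
Definition cts_of (f : Omega -> K) : cfun Omega K :=
  if pselect (continuous (f : Omega -> K^o)) is left cf then mkcts cf
  else cts_zero _ _.

Lemma cts_ofE (f : Omega -> K) : continuous (f : Omega -> K^o) ->
  cts_of f = f :> (Omega -> K).
Proof. by rewrite /cts_of; case: pselect. Qed.

Lemma dualP (nu : dual K Omega) : linear nu /\ exists b, dnorm_le nu b.
Proof. by have := dual_valP nu; rewrite inE => -[]. Qed.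

Lemma dualD (nu : dual K Omega) x y : nu (x + y) = nu x + nu y.
Proof. by have [/(_ 1 x y)] := dualP nu; rewrite !scale1r. Qed.

Lemma dual0 (nu : dual K Omega) : nu 0 = 0.
Proof. by apply: (addrI (nu 0)); rewrite -dualD !addr0. Qed.

Lemma dualZ (nu : dual K Omega) a x : nu (a *: x) = a * nu x.
Proof. by have [/(_ a x 0)] := dualP nu; rewrite dual0 !addr0. Qed.

Lemma pairing_sum n (c : 'I_n -> K) (nu : 'I_n -> dual K Omega) x :
  pairing x (\sum_(j < n) c j *: nu j) = \sum_(j < n) c j * pairing x (nu j).
Proof.
pose ev (mu : dual K Omega) := pairing x mu.
have evD mu mu' : ev (mu + mu') = ev mu + ev mu' by [].
have evZ a mu : ev (a *: mu) = a * ev mu by [].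
have ev0 : ev 0 = 0 by [].
rewrite -/(ev _) (big_morph ev evD ev0).
by apply: eq_bigr => j _; rewrite evZ.
Qed.

Variable phi : continuousType Omega Omega.

Lemma iter_koopmanE k (x : cfun Omega K) w :
  iter k (koopman phi) x w = x (iter k phi w).
Proof.
elim: k w => // k IH w; rewrite [in RHS]iterSr; exact: (IH (phi w)).
Qed.

Lemma pairing_iter_adjoint k (x : cfun Omega K) (nu : dual K Omega) :
  pairing x (iter k (koopman_adjoint phi) nu) =
  pairing (iter k (koopman phi) x) nu.
Proof.
by elim: k x => // k IH x; rewrite [in RHS]iterSr; exact: (IH (koopman phi x)).
Qed.

Lemma G0_pairing T : G0 phi T -> exists n (c : 'I_n -> K) (k : 'I_n -> nat),
  [/\ forall j, 0 <= c j, \sum_(j < n) c j = 1 &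
    forall x nu, pairing x (T nu) =
      \sum_(j < n) c j * pairing (iter (k j) (koopman phi) x) nu].
Proof.
move=> [n [c [a [c0 c1 aP ->]]]].
have /choice[k kP] j : exists k, a j = iter k (koopman_adjoint phi).
  by have [k _ <-] := aP j; exists k.
exists n, c, k; split=> // x nu.
rewrite fct_sumE pairing_sum; apply: eq_bigr => j _.
by rewrite kP pairing_iter_adjoint.
Qed.

End continuous_elements.

(** The hypothesis [0 <= a] makes [a] real, hence comparable with [|l|] even when [K] is complex. *)
Lemma cvg_normK_le (K : numFieldType) (I : Type) (F : set_system I)
    (u : I -> K^o) (l : K^o) (a : K) : ProperFilter F -> 0 <= a ->
  (forall i, `|u i| <= a) -> u @ F --> l -> `|l| <= a.
Proof.
move=> FF a0 ua ul; rewrite real_leNgt ?ger0_real//; apply/negP => al.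
move/cvgrPdist_lt : ul => /(_ (`|l| - a)); rewrite subr_gt0 => /(_ al) ul.
have [i li] := filter_ex ul.
have : `|l| < `|l|.
  rewrite -{1}(subrK (u i) l) (le_lt_trans (ler_normD _ _))//.
  by rewrite -[ltRHS](subrK a) ltr_leD.
by rewrite ltxx.
Qed.

Section dual_convergence.
Variables (K : numFieldType) (Omega : topologicalType).
Variable phi : continuousType Omega Omega.

Lemma cts_sumE n (c : 'I_n -> K) (x : 'I_n -> cfun Omega K) w :
  (\sum_(j < n) c j *: x j) w = \sum_(j < n) c j * x j w.
Proof.
pose ev (y : cfun Omega K) : K := y w.
have evD y y' : ev (y + y') = ev y + ev y' by [].
have evZ a y : ev (a *: y) = a * ev y by [].
have ev0 : ev 0 = 0 by [].
rewrite -/(ev _) (big_morph ev evD ev0).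
by apply: eq_bigr => j _; rewrite evZ.
Qed.

Lemma dual_sum n (c : 'I_n -> K) (x : 'I_n -> cfun Omega K)
    (nu : dual K Omega) :
  nu (\sum_(j < n) c j *: x j) = \sum_(j < n) c j * nu (x j).
Proof.
rewrite (big_morph nu (dualD nu) (dual0 nu)).
by apply: eq_bigr => j _; rewrite dualZ.
Qed.

Let dirac_subproof (w : Omega) :
  (fun x : cfun Omega K => x w : K^o) \in @bounded_functional K Omega.
Proof.
rewrite inE; split=> [a x y//|]; exists 1; split=> // x a [_ xa].
by rewrite mul1r.
Qed.

Definition dual_dirac (w : Omega) : dual K Omega := Dual (dirac_subproof w).

(** Elements of [G0] preserve every dual norm bound. Hence the pointwise limits are bounded
    functionals and form an operator with bound 1. *)
Lemma wso_convergent_pointwise (I : Type) (F : set_system I)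
    (T : I -> dual K Omega -> dual K Omega) : ProperFilter F ->
  (forall i, G0 phi (T i)) ->
  (forall x nu, exists l : K^o, (fun i => pairing x (T i nu)) @ F --> l) ->
  wso_convergent F T.
Proof.
move=> FF GT Tcvg.
have /choice[L LP] (xn : cfun Omega K * dual K Omega) :
    exists l : K^o, (fun i => pairing xn.1 (T i xn.2)) @ F --> l.
  exact: Tcvg.
have uniq (u : I -> K^o) (l l' : K^o) : u @ F --> l -> u @ F --> l' -> l = l'.
  by apply: cvg_unique; exact: norm_hausdorff.
have bnd i (nu : dual K Omega) b : dnorm_le nu b -> dnorm_le (T i nu) b.
  have [n [c [k [c0 c1 TE]]]] := G0_pairing (GT i).
  move=> [b0 nub]; split=> // x a [a0 xa]; rewrite -/(pairing x _) TE.
  rewrite (le_trans (ler_norm_sum _ _ _))// -[leRHS]mul1r -c1 mulr_suml.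
  apply: ler_sum => j _; rewrite normrM ger0_norm// ler_wpM2l//.
  by apply: nub; split=> // w; rewrite iter_koopmanE.
have Tlin i a (mu nu : dual K Omega) x :
    pairing x (T i (a *: mu + nu)) =
    a * pairing x (T i mu) + pairing x (T i nu).
  have [n [c [k [c0 c1 TE]]]] := G0_pairing (GT i).
  rewrite !TE mulr_sumr -big_split; apply: eq_bigr => j _.
  by rewrite /= [in RHS]mulrCA -[RHS]mulrDr.
have LB nu : (fun x => L (x, nu)) \in @bounded_functional K Omega.
  rewrite inE; have [_ [b nub]] := dualP nu; split.
    move=> a x y; apply: (uniq (fun i => pairing (a *: x + y) (T i nu))).
      exact: (LP (a *: x + y, nu)).
    rewrite /pairing; under eq_fun do rewrite dualD dualZ.
    apply: cvgD; last exact: (LP (y, nu)).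
    by apply: cvgM; [exact: cvg_cst|exact: (LP (x, nu))].
  have [b0 _] := nub; exists b; split=> // x a xa; have [a0 _] := xa.
  apply: (cvg_normK_le FF _ _ (LP (x, nu))); first by rewrite mulr_ge0.
  by move=> i; apply: (bnd i _ _ nub).2.
exists (fun nu => Dual (LB nu)); last by move=> x nu; exact: (LP (x, nu)).
split.
  move=> a mu nu; apply/val_inj/funext => x /=.
  apply: (uniq (fun i => pairing x (T i (a *: mu + nu)))).
    exact: (LP (x, a *: mu + nu)).
  under eq_fun do rewrite Tlin.
  apply: cvgD; last exact: (LP (x, nu)).
  by apply: cvgM; [exact: cvg_cst|exact: (LP (x, mu))].
exists 1 => nu b nub; rewrite mul1r; have [b0 _] := nub; split=> // x a xa.
have [a0 _] := xa.
apply: (cvg_normK_le FF _ _ (LP (x, nu))); first by rewrite mulr_ge0.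
by move=> i; apply: (bnd i _ _ nub).2.
Qed.

End dual_convergence.

(** * Reduction to real functions and real functionals *)

Section reduction.
Variables (R : realType) (K : numFieldType) (Omega : topologicalType).
Variables (S : scalar_structure R K) (phi : continuousType Omega Omega).
Local Notation iota := (iota S).

Lemma iota_inj : injective iota.
Proof. by move=> r s rs; apply/eqP; rewrite eq_le -!(iota_le S) rs lexx. Qed.

Lemma iota_lt r s : (iota r < iota s) = (r < s).
Proof. by rewrite !lt_neqAle iota_le (inj_eq iota_inj). Qed.

Lemma gt0_re e : 0 < e -> 0 < re S e.
Proof. by move=> e0; rewrite -iota_lt rmorph0 ge0_re// ltW. Qed.

Lemma iota_continuous : continuous (iota : R -> K^o).
Proof.
move=> r; apply/cvgrPdist_lt => e e0.
have : (id : R -> R) @ r --> r by exact: cvg_id.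
move/cvgrPdist_lt => /(_ _ (gt0_re e0)); apply: filterS => s rs.
by rewrite -rmorphB iota_norm -(ge0_re S (ltW e0)) iota_lt.
Qed.

Lemma iota_comp_continuous (f : Omega -> R) : continuous f ->
  continuous (iota \o f : Omega -> K^o).
Proof.
by move=> cf w; apply: continuous_comp; [exact: cf|exact: iota_continuous].
Qed.

Section parts.
Variable rho : K -> R.
Hypothesis rhoP : real_part iota rho.

Lemma real_partB z z' : rho (z - z') = rho z - rho z'.
Proof.
have [rhoD rhoZ _] := rhoP; rewrite rhoD -mulN1r -(rmorphN1 iota) rhoZ.
by rewrite mulN1r.
Qed.

Lemma real_part_continuous : continuous (rho : K^o -> R).
Proof.
have [rhoD rhoZ rhole] := rhoP; move=> z.
apply/(cvgrPdist_lt (FF := nbhs_filter (z : K^o))) => e e0.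
have ie0 : 0 < iota e by rewrite -(rmorph0 iota) iota_lt.
have := nbhsx_ballx (z : K^o) _ ie0; rewrite -ball_normE.
apply: filterS => s zs.
by rewrite -real_partB -iota_lt (le_lt_trans (rhole _)).
Qed.

Lemma bounded_on_real_part (nu : dual K Omega) : exists b : R,
  bounded_on setT b (fun f : Omega -> R => rho (nu (cts_of (iota \o f)))).
Proof.
have [rhoD rhoZ rhole] := rhoP; have [_ [b [b0 nub]]] := dualP nu.
exists (re S b); split.
- by rewrite -(iota_le S) rmorph0 ge0_re.
- move=> f g cf cg; rewrite -rhoD -dualD; congr (rho (nu _)).
  have cfg : continuous (f \+ g) by move=> w; apply: cvgD; [exact: cf|exact: cg].
  apply/continuousEP => w; rewrite cts_ofE; last exact: iota_comp_continuous.
  by rewrite /= rmorphD/= -[RHS]/(cts_of _ w + cts_of _ w) !cts_ofE//; exact: iota_comp_continuous.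
- move=> k f cf; rewrite -rhoZ -dualZ; congr (rho (nu _)).
  have ckf : continuous (k \*o f) by move=> w; apply: cvgM; [exact: cvg_cst|exact: cf].
  apply/continuousEP => w; rewrite cts_ofE; last exact: iota_comp_continuous.
  by rewrite /= rmorphM/= -[RHS]/(iota k * cts_of _ w) !cts_ofE//; exact: iota_comp_continuous.
- move=> f a cf a0 fa; rewrite -(iota_le S) (le_trans (rhole _))//.
  rewrite rmorphM/= ge0_re//; apply: nub; split=> [|w].
    by rewrite -(rmorph0 iota) iota_le.
  by rewrite cts_ofE/= ?iota_norm ?iota_le ?fa//; exact: iota_comp_continuous.
Qed.

End parts.

(** Coefficients that are nonnegative in [K] are real, so [re S] turns them into real convex
    coefficients. *)
Lemma G0_orbit_average (T : dual K Omega -> dual K Omega) : G0 phi T ->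
  exists2 A, orbit_average (R := R) phi A & forall (f : Omega -> R) nu,
    continuous f -> pairing (cts_of (iota \o f)) (T nu) =
      pairing (cts_of (iota \o A f)) nu.
Proof.
move=> /G0_pairing[n [c [k [c0 c1 TE]]]].
pose A (f : Omega -> R) w := \sum_(j < n) re S (c j) * f (iter (k j) phi w).
have avgA : orbit_average phi A.
  exists n, (re S \o c), k; split=> [j||//].
    by rewrite -(iota_le S) rmorph0 ge0_re.
  apply: iota_inj; rewrite rmorph1 rmorph_sum -c1.
  by apply: eq_bigr => j _; rewrite /= ge0_re.
exists A => // f nu cf; rewrite TE /pairing -dual_sum; congr (nu _).
apply/continuousEP => w; rewrite cts_sumE cts_ofE; last first.
  by apply/iota_comp_continuous/(orbit_average_continuous avgA) => //; exact: cts_fun.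
rewrite /= rmorph_sum; apply: eq_bigr => j _.
by rewrite iter_koopmanE cts_ofE ?rmorphM/= ?ge0_re//; exact: iota_comp_continuous.
Qed.

(** Splitting both the function and the functional into real and imaginary parts leaves four
    convergence problems over [R]. *)
Lemma unique_minimal_wso_convergent (I : Type) (F : set_system I)
    (T : I -> dual K Omega -> dual K Omega) :
  compact [set: Omega] -> hausdorff_space Omega -> ordinary R phi ->
  (forall w, exists! m, minimal_set phi m /\ m `<=` orbit_closure phi w) ->
  ProperFilter F -> ergodic phi F T -> wso_convergent F T.
Proof.
move=> cO hO ordphi mu1 FF [GT ergT].
have /choice[A AP] i : exists A, orbit_average (R := R) phi A /\
    forall (f : Omega -> R) nu, continuous f ->
      pairing (cts_of (iota \o f)) (T i nu) =
      pairing (cts_of (iota \o A f)) nu.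
  by have [A] := G0_orbit_average (GT i); exists A.
have cphi : continuous phi by exact: cts_fun.
have cA i f : continuous f -> continuous (A i f).
  exact: (orbit_average_continuous (AP i).1).
(* Ergodicity tested against the Dirac functional at [w] is the pointwise condition on the real
   averages. *)
have ergA g w : continuous g -> A i g w - A i (g \o phi) w @[i --> F] --> 0.
  move=> cg; apply/cvgrPdist_lt => e e0.
  have := ergT (cts_of (iota \o g)) (dual_dirac K w).
  have ie0 : 0 < iota e by rewrite -(rmorph0 iota) iota_lt.
  move/cvgrPdist_lt => /(_ _ ie0); apply: filterS => i.
  rewrite /= (AP i).2// /pairing.
  rewrite -[X in `|_ - X|]/(cts_of (iota \o A i g) w -
    cts_of (iota \o A i g) (phi w)).
  rewrite cts_ofE; last exact/iota_comp_continuous/cA.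
  rewrite -[X in `|X - _|]/(0 : K) /= -rmorphB -(rmorph0 iota) -rmorphB/=.
  by rewrite iota_norm iota_lt (orbit_average_comp (AP i).1).
have real_cvg (f : Omega -> R) nu : continuous f ->
    exists l : K^o, pairing (cts_of (iota \o f)) (T i nu) @[i --> F] --> l.
  move=> cf.
  have part rho : real_part iota rho -> exists l : R,
      rho (nu (cts_of (iota \o A i f))) @[i --> F] --> l.
    move=> /bounded_on_real_part/(_ nu)[b mub].
    have /cvg_ex[l lP] := ordinary_orbit_average_cvg cO hO cphi ordphi mu1 FF
      (fun i => (AP i).1) ergA cf mub.
    by exists l.
  have [l1 l1P] := part _ (re_part S).
  have [l2 l2P] := part _ (im_part S).
  exists (iota l1 + imag_unit S * iota l2).
  under eq_fun do rewrite (AP _).2// /pairing (scalarE S (nu _)).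
  apply: cvgD; last apply: cvgM; first last.
  - exact: (continuous_cvg _ (@iota_continuous l2) l2P).
  - exact: cvg_cst.
  - exact: (continuous_cvg _ (@iota_continuous l1) l1P).
apply: (wso_convergent_pointwise FF GT) => x nu.
have cx rho : real_part iota rho -> continuous (rho \o x).
  move=> rhoP w; apply: continuous_comp; first exact: cts_fun.
  exact: real_part_continuous.
have cre := cx _ (re_part S); have cim := cx _ (im_part S).
have [l1 l1P] := real_cvg _ nu cre; have [l2 l2P] := real_cvg _ nu cim.
exists (l1 + imag_unit S * l2).
have xE : x = cts_of (iota \o (re S \o x)) +
    imag_unit S *: cts_of (iota \o (im S \o x)).
  apply/continuousEP => w.
  rewrite -[RHS]/(cts_of _ w + imag_unit S * cts_of _ w) !cts_ofE; try exact: iota_comp_continuous.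
  exact: scalarE.
rewrite {1}xE /pairing; under eq_fun do rewrite dualD dualZ.
by apply: cvgD; [exact: l1P|apply: cvgM; [exact: cvg_cst|exact: l2P]].
Qed.

End reduction.

(** * Divergence with two minimal sets *)

Section shifted_averages.
Variables (K : numFieldType) (Omega : topologicalType).
Variable phi : continuousType Omega Omega.

(** Cesàro means over a window; the start [k] selects the stretch of the trajectory that is
    sampled. *)
Definition shifted_average (n k : nat) : dual K Omega -> dual K Omega :=
  \sum_(j < n.+1) n.+1%:R^-1 *: iter (j + k) (koopman_adjoint phi).

Lemma G0_shifted_average n k : G0 phi (shifted_average n k).
Proof.
exists n.+1, (fun=> n.+1%:R^-1), (fun j => iter (j + k) (koopman_adjoint phi)).
split=> //.
by rewrite sumr_const card_ord -[LHS]mulr_natr mulVf.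
Qed.

Lemma shifted_averageE n k x nu : pairing x (shifted_average n k nu) =
  n.+1%:R^-1 * \sum_(j < n.+1) pairing (iter (j + k) (koopman phi) x) nu.
Proof.
rewrite /shifted_average fct_sumE pairing_sum mulr_sumr.
by apply: eq_bigr => j _; rewrite pairing_iter_adjoint.
Qed.

Lemma shifted_average_coboundary n k x nu :
  pairing x (shifted_average n k (nu - koopman_adjoint phi nu)) =
  n.+1%:R^-1 * (pairing (iter k (koopman phi) x) nu -
                pairing (iter (n.+1 + k) (koopman phi) x) nu).
Proof.
rewrite shifted_averageE; congr (_ * _).
pose u j := pairing (iter (j + k) (koopman phi) x) nu.
transitivity (\sum_(j < n.+1) (u j - u j.+1)); first exact: eq_bigr.
rewrite -[RHS]/(u 0%N - u n.+1) -[RHS]opprB.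
rewrite -(telescope_sumr u (leq0n n.+1)) big_mkord -sumrN.
by apply: eq_bigr => j _; rewrite opprB.
Qed.

Lemma iter_adjoint_bound k x (nu : dual K Omega) b a : dnorm_le nu b ->
  norm_le x a -> `|pairing (iter k (koopman phi) x) nu| <= b * a.
Proof.
move=> [_ nub] [a0 xa]; apply: nub; split=> // w.
by rewrite iter_koopmanE.
Qed.

End shifted_averages.

Section converse.
Variables (R : realType) (K : numFieldType) (Omega : topologicalType).
Variables (S : scalar_structure R K) (phi : continuousType Omega Omega).
Hypothesis Omega_compact : compact [set: Omega].
Hypothesis Omega_hausdorff : hausdorff_space Omega.
Local Notation iota := (iota S).

Lemma cts_norm_le (x : cfun Omega K) : exists a, norm_le x a.
Proof.
have cnx : continuous (fun w => re S `|x w|).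
  move=> w; apply: (@continuous_comp _ _ _ (fun w => `|x w| : K^o) (re S)).
    by apply: (@cvg_norm K K^o); exact: cts_fun.
  exact: (real_part_continuous (re_part S)).
have [a xa] := continuous_compact_bounded Omega_compact cnx.
exists (iota `|a|); split=> [|w]; first by rewrite -iota_norm.
by rewrite -(ge0_re S (normr_ge0 (x w))) iota_le (le_trans (ler_norm _))//
  (le_trans (xa w))// ler_norm.
Qed.

(** The Archimedean property is transferred from [R] through [iota]. *)
Lemma scalar_inv_natr_cvg0 (C : K) : 0 <= C ->
  C * n.+1%:R^-1 @[n --> \oo] --> (0 : K^o).
Proof.
move=> C0; apply/cvgrPdist_lt => e e0.
have d0 : 0 < re S e / (re S C + 1).
  rewrite divr_gt0 ?gt0_re// ltr_wpDl//.
  by rewrite -(iota_le S) rmorph0 ge0_re.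
have [N _ NP] := near_infty_natSinv_lt (PosNum d0).
exists N => // n Nn; rewrite /= sub0r normrN ger0_norm; last first.
  by rewrite mulr_ge0.
rewrite -(ge0_re S C0) -(ge0_re S (ltW e0)) -(rmorph_nat iota) -fmorphV -rmorphM.
have C1 : 0 < re S C + 1 by rewrite ltr_wpDl// -(iota_le S) rmorph0 ge0_re.
rewrite iota_lt (@le_lt_trans _ _ ((re S C + 1) * n.+1%:R^-1))//.
  by rewrite ler_wpM2r// lerDl.
by rewrite mulrC -ltr_pdivlMr//; exact: NP.
Qed.

(** Telescoping leaves two end terms, so the pairing is at most [(b * a + b * a) / n.+1] whatever
    the starts [k n] are. *)
Lemma ergodic_shifted_average (k : nat -> nat) :
  ergodic phi \oo (fun n => shifted_average (K := K) phi n (k n)).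
Proof.
split=> [n|x nu]; first exact: G0_shifted_average.
have [_ [b nub]] := dualP nu; have [a xa] := cts_norm_le x.
have [b0 _] := nub; have [a0 _] := xa.
have C0 : 0 <= b * a + b * a by rewrite addr_ge0// mulr_ge0.
have := scalar_inv_natr_cvg0 C0; move/cvgrPdist_lt => CP.
apply/cvgrPdist_lt => e /CP; apply: filterS => n.
rewrite -[X in _ -> `|X - _| < _]/(0 : K) !sub0r !normrN => /(le_lt_trans _); apply.
rewrite [pairing _ _]shifted_average_coboundary [leRHS]ger0_norm; last first.
  by rewrite mulr_ge0.
rewrite normrM ger0_norm// mulrC ler_wpM2r//.
rewrite (le_trans (ler_normD _ _))// normrN.
by apply: lerD; exact: iter_adjoint_bound.
Qed.

(** Urysohn's lemma over [R], transported by [iota]. *)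
Lemma closed_separation (m m' : set Omega) : closed m -> closed m' ->
  m `&` m' = set0 -> exists f : cfun Omega K,
    (forall w, m w -> f w = 0) /\ (forall w, m' w -> f w = 1).
Proof.
move=> cm cm' mm'.
have nO : normal_space Omega by exact: compact_normal.
have /(@uniform_separatorP _ R)[f [cf _ f0 f1]] :=
  (@normal_separatorP R Omega).1 nO m m' cm cm' mm'.
exists (cts_of (iota \o f)).
have E : cts_of (iota \o f) = iota \o f :> (Omega -> K).
  apply: cts_ofE => w; apply: continuous_comp; first exact: cf.
  exact: iota_continuous.
split=> w mw; rewrite E /=.
  by rewrite (f0 (f w)) ?rmorph0//; exists w.
by rewrite (f1 (f w)) ?rmorph1//; exists w.
Qed.

(* An orbit that approaches an invariant set on which f = c stays close to it
   for n steps. *)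
Lemma shifted_average_near (f : cfun Omega K) (m : set Omega) (c e : K) w n :
  closed_invariant phi m -> m `<=` orbit_closure phi w ->
  (forall v, m v -> f v = c) -> 0 < e ->
  exists k, `|c - pairing f (shifted_average phi n k (dual_dirac K w))| <= e.
Proof.
move=> mi mw fc e0; have [[v mv] _ _] := mi.
(* The trajectory of [v] stays in [m], where [f] equals [c]; the finitely many continuity conditions
   at [v] share a neighbourhood. *)
have vU : nbhs v [set y | forall j : 'I_n.+1, `|c - f (iter j phi y)| < e].
  apply: filter_forall => j.
  have : (fun y => f (iter j phi y)) @ v --> (c : K^o).
    rewrite -(fc (iter j phi v)); last exact: closed_invariant_iter.
    apply: continuous_comp; last exact: cts_fun.
    by apply: continuous_iter; exact: cts_fun.
  by move/cvgrPdist_lt/(_ e e0).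
have [_ [[k _ <-] kU]] := mw _ mv _ vU.
exists k; rewrite shifted_averageE.
have -> : c = n.+1%:R^-1 * \sum_(j < n.+1) c.
  by rewrite sumr_const card_ord -[c *+ _]mulr_natl mulKf.
rewrite -mulrBr -sumrB normrM ger0_norm//.
rewrite ler_pdivrMl// (le_trans (ler_norm_sum _ _ _))//.
have -> : n.+1%:R * e = \sum_(j < n.+1) e by rewrite sumr_const card_ord mulr_natl.
apply: ler_sum => j _; rewrite /pairing/= iter_koopmanE iterD.
by apply: ltW; exact: kU.
Qed.

Lemma ergodic_sequences_unique_minimal :
  ergodic_sequences_converge K phi ->
  forall w, exists! m, minimal_set phi m /\ m `<=` orbit_closure phi w.
Proof.
move=> seqcvg w; have cphi : continuous phi by exact: cts_fun.
have [m mmin mw] :=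
  exists_minimal_set Omega_compact (closed_invariant_orbit_closure cphi w).
exists m; split=> // m' [m'min m'w]; apply: contrapT => mm'.
have [mi _] := mmin; have [m'i _] := m'min.
have [_ cm _] := mi; have [_ cm' _] := m'i.
have [f [f0 f1]] := closed_separation cm cm' (minimal_set_disjoint mmin m'min mm').
(* Passing from 0 to the limit and from the limit to 1 costs each time at most 1/4 for the sampling
   and less than 1/4 for convergence, in total less than 1. *)
have e0 : 0 < 4^-1 :> K by rewrite invr_gt0.
have /choice[k kP] n : exists k, `|(odd n)%:R -
    pairing f (shifted_average phi n k (dual_dirac K w))| <= 4^-1.
  case: (odd n).
    exact: (shifted_average_near n m'i m'w f1 e0).
  exact: (shifted_average_near n mi mw f0 e0).
have [T _ /(_ f (dual_dirac K w)) ST] := seqcvg _ (ergodic_shifted_average k).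
set l := pairing f (T _) in ST.
move/cvgrPdist_lt : ST => /(_ _ e0)[N _ NP].
pose u n := pairing f (shifted_average phi n (k n) (dual_dirac K w)).
have lodd n : (N <= n)%N -> `|(odd n)%:R - l| < 4^-1 + 4^-1.
  move=> /NP; rewrite distrC => lu.
  rewrite -(subrK (u n) (odd n)%:R) -addrA (le_lt_trans (ler_normD _ _))//.
  by rewrite ler_ltD//; exact: kP.
have := lodd N.*2.+1; rewrite /= odd_double => /(_ _).
have := lodd N.*2; rewrite odd_double sub0r normrN => /(_ _).
have NN : (N <= N.*2)%N by rewrite -addnn leq_addr.
move=> /(_ NN) l0 /(_ (leqW NN)) l1.
have : `|1 : K| < 4^-1 + 4^-1 + (4^-1 + 4^-1).
  have := ler_normD (1 - l) l; rewrite subrK => /le_lt_trans; apply.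
  exact: ltrD.
by rewrite normr1 -!mulr2n -mulrnA -[X in _ < X]mulr_natr mulVf ?ltxx.
Qed.

End converse.

(** * Nets, sequences and the two equivalences *)

Lemma tails_proper (D : Type) (le : D -> D -> Prop) : directed le ->
  ProperFilter (tails le).
Proof.
move=> [[d0] le_refl le_trans le_dir].
apply: Build_ProperFilter_ex; first by move=> A [a aA]; exists a; exact: aA.
split.
- by exists d0.
- move=> A B [a aA] [b bB]; have [c ac bc] := le_dir a b.
  by exists c => d cd; split; [exact/aA/le_trans/cd|exact/bB/le_trans/cd].
- by move=> A B AB [a aA]; exists a => b /aA/AB.
Qed.

Lemma tails_leq : tails (fun a b : nat => (a <= b)%N) = \oo.
Proof.
apply/seteqP; split=> A; first by move=> [a aA]; exists a.
by move=> [a _ aA]; exists a.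
Qed.

Lemma ergodic_nets_sequences (K : numFieldType) (Omega : topologicalType)
    (phi : continuousType Omega Omega) :
  ergodic_nets_converge K phi -> ergodic_sequences_converge K phi.
Proof.
move=> nets _ T ergT; have := nets nat (fun a b => (a <= b)%N) T.
rewrite tails_leq; apply => //; split=> [|a|a b c|a b].
- exact: (inhabits 0%N).
- exact: leqnn.
- exact: leq_trans.
- by exists (maxn a b); [exact: leq_maxl|exact: leq_maxr].
Qed.

Theorem theorem3p5 (R : realType) (K : numFieldType)
    (scalarK : K = (R : numFieldType) \/ K = (R[i] : numFieldType))
    (Omega : topologicalType) (Omega_compact : compact [set: Omega])
    (Omega_metrizable : metrizable R Omega)
    (phi : continuousType Omega Omega) (phi_ordinary : ordinary R phi) :
  (ergodic_nets_converge K phi <->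
     forall w, exists! m, minimal_set phi m /\ m `<=` orbit_closure phi w) /\
  (ergodic_sequences_converge K phi <->
     forall w, exists! m, minimal_set phi m /\ m `<=` orbit_closure phi w).
Proof.
have [S] := scalar_structureP scalarK.
have hO := metrizable_hausdorff Omega_metrizable.
have nets : (forall w, exists! m,
    minimal_set phi m /\ m `<=` orbit_closure phi w) ->
    ergodic_nets_converge K phi.
  move=> mu1 _ D le T dle.
  exact: (unique_minimal_wso_convergent S Omega_compact hO phi_ordinary mu1
    (tails_proper dle)).
have seqs := ergodic_sequences_unique_minimal S Omega_compact hO (phi := phi).
(* The implications form a cycle: uniqueness gives nets, nets give sequences, and sequences give
   uniqueness. *)
split; split=> [conv|/nets//].
- exact/seqs/ergodic_nets_sequences.
- exact: seqs.
- exact: ergodic_nets_sequences.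
Qed.
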